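(* Let $N\ge 1$ and $p>1$. Let $f\in\mathcal L$, and let $h\in\mathcal L'$ if $1<p<2$ and $h=0$ if $p\ge2$. Consider problem (P) with $$\mu=x_Nf(x)+h(x')\otimes\delta_1(x_N)\in\mathcal M.$$ Let $\Phi$ be a strictly increasing, nonnegative, and convex function on $[0,\infty)$ with $\Phi(0)=0$. Set $$v(x,t):=2\Phi^{-1}\big([G(t)\Phi(f)](x)\big),\qquad w(x,t):=2\frac{x_N}{t}\Gamma_1(x_N,t)\,\Phi^{-1}\big([\Gamma_{N-1}(t)\Phi(h)](x')\big)$$ for $(x,t)\in Q_\infty$. Define $$A(\tau):=\frac{\Phi^{-1}(\tau)^p}{\tau},\qquad B(\tau):=\frac{\tau}{\Phi^{-1}(\tau)},\qquad\tau>0.$$ If $$\sup_{t\in(0,T)}\left(\|B(G(t)\Phi(f))\|_\infty\int_0^t\|A(G(s)\Phi(f))\|_\infty\,ds\right)\le2^{-2p+1},$$ $$\sup_{t\in(0,T)}\left(\|B(\Gamma_{N-1}(t)\Phi(h))\|_\infty\int_0^ts^{-(p-1)}\|A(\Gamma_{N-1}(s)\Phi(h))\|_\infty\,ds\right)\le2^{-2p+1}(2e\pi)^{\frac{p-1}2},$$ for some $T>0$, then problem (P) possesses a solution $u$ in $Q_T$ such that $$0\le u(x,t)\le v(x,t)+w(x,t)\qquad\text{for almost all }(x,t)\in Q_T.$$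
   Context: $\Omega:=\mathbb R^{N-1}\times(0,\infty)$ if $N\ge2$ and $\Omega:=(0,\infty)$ if $N=1$; points are written $x=(x',x_N)$; $\partial\Omega$ is identified with $\mathbb R^{N-1}$ ($\{0\}$ if $N=1$). $Q_T:=\Omega\times(0,T)$ for $T\in(0,\infty]$. $\mathcal M$ is the set of nonnegative Radon measures on $\overline\Omega$; a locally integrable function $g$ on $\overline\Omega$ is identified with the measure $g(x)\,dx$. $\mathcal L$ (resp. $\mathcal L'$) is the set of nonnegative measurable functions on $\Omega$ (resp. $\partial\Omega$). $\mathcal L(Q_T)$ is the set of nonnegative, measurable, almost everywhere finite functions on $Q_T$. $\delta_1$ is the Dirac measure at $0$ in the variable $x_N$, and $h(x')\otimes\delta_1(x_N)$ is the measure carried by $\partial\Omega$ with density $h$ with respect to Lebesgue measure $dx'$ (for $N=1$ it is $h(0)\delta_1$). Kernels: $\Gamma_d(x,t):=(4\pi t)^{-d/2}\exp(-|x|^2/(4t))$ on $\mathbb R^d\times(0,\infty)$. The Dirichlet heat kernel of $\Omega$ is $$G(x,y,t):=\Gamma_N(x-y,t)\left(1-\exp\left(-\frac{x_Ny_N}{t}\right)\right),\qquad x,y\in\overline\Omega,\ t>0,$$ and, for $x,y\in\overline\Omega$, $t>0$, $K(x,y,t):=y_N^{-1}G(x,y,t)$ if $y_N>0$ and $K(x,y,t):=(\partial_{y_N}G)(x,y,t)=\frac{x_N}{t}\Gamma_N(x-y,t)$ if $y_N=0$. $[G(t)f](x):=\int_\Omega G(x,y,t)f(y)\,dy$ and $[\Gamma_{N-1}(t)h](x'):=\int_{\mathbb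 R^{N-1}}\Gamma_{N-1}(x'-y',t)h(y')\,dy'$ (for $N=1$, $[\Gamma_0(t)h]:=h(0)$). $\|\cdot\|_\infty$ is the sup norm ($L^\infty$) over $\Omega$, respectively over $\partial\Omega$. In the hypotheses, $G(t)\Phi(f)$ and $\Gamma_{N-1}(t)\Phi(h)$ are understood to be finite for $t\in(0,T)$ so that the compositions with $A$, $B$, $\Phi^{-1}$ make sense; if $f=0$ a.e. (resp. $h=0$ a.e.) the first (resp. second) smallness condition is regarded as satisfied, and $v=0$ (resp. $w=0$). Problem (P) is $\partial_tu=\Delta u+u^p$ in $\Omega$, $t>0$, with $u=0$ on $\partial\Omega$ and $x_Nu(x,0)=\mu$ on $\overline\Omega$. A function $u\in\mathcal L(Q_T)$ is a solution to (P) in $Q_T$ if $$u(x,t)=\int_{\overline\Omega}K(x,y,t)\,d\mu(y)+\int_0^t\int_\Omega G(x,y,t-s)u(y,s)^p\,dy\,ds$$ for almost all $(x,t)\in Q_T$. *)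

(* Defs.v *)
From HB Require Import structures.
From mathcomp Require Import all_boot all_order all_algebra.
From mathcomp Require Import all_classical all_reals all_analysis.
From mathcomp Require Import measurable_realfun ess_sup_inf.

Set Implicit Arguments.
Unset Strict Implicit.
Unset Printing Implicit Defensive.

Import Order.TTheory GRing.Theory Num.Theory.
Import numFieldNormedType.Exports.

Local Open Scope classical_set_scope.
Local Open Scope ring_scope.

(* Boundary points x' range over R^(N-1), points x = (x', x_N) over
   R^(N-1) * R; for N = 1 the type 0.-tuple has exactly one element. *)
Notation bdry R N := ((N.-1).-tuple (measurableTypeR R)).
Notation ambient R N := ((bdry R N * measurableTypeR R)%type).

(* The library does not infer a sigma-finite structure on [m1 \x m2] (its
   instance for finite measures takes precedence), hence this copy. *)
Section sigma_finite_product.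
Context d1 d2 (T1 : measurableType d1) (T2 : measurableType d2) (R : realType).
Variable m1 : {sigma_finite_measure set T1 -> \bar R}.
Variable m2 : {sigma_finite_measure set T2 -> \bar R}.
Local Open Scope ereal_scope.

Definition sfprod : set (T1 * T2) -> \bar R := m1 \x m2.

HB.instance Definition _ := Measure.copy sfprod (m1 \x m2).

Let sfprod_sigma_finite : sigma_finite setT sfprod.
Proof.
have /sigma_finiteP[F [TF ndF Foo]] := sigma_finiteT m1.
have /sigma_finiteP[H [TH ndH Hoo]] := sigma_finiteT m2.
exists (fun n => F n `*` H n).
  rewrite -setXTT TF TH predeqE => -[x y]; split.
    move=> [/= [n _ Fnx] [k _ Hky]]; exists (maxn n k) => //; split.
    - by move: x Fnx; exact/subsetPset/ndF/leq_maxl.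
    - by move: y Hky; exact/subsetPset/ndH/leq_maxr.
  by move=> [n _ []/= ? ?]; split; exists n.
move=> k; have [? ?] := Foo k; have [? ?] := Hoo k.
split; first exact: measurableX.
by rewrite /sfprod product_measure1E// lte_mul_pinfty// ge0_fin_numE.
Qed.

HB.instance Definition _ := Measure_isSigmaFinite.Build _ _ _ sfprod
  sfprod_sigma_finite.
End sigma_finite_product.

Section tuple_lebesgue.
Context {R : realType}.
Local Open Scope ereal_scope.

Definition tcons n (z : measurableTypeR R * n.-tuple (measurableTypeR R)) :
  n.+1.-tuple (measurableTypeR R) := [tuple of z.1 :: z.2].

Lemma measurable_tcons n : measurable_fun setT (@tcons n).
Proof. exact: (measurable_cons measurable_fst measurable_snd). Qed.

Section step.
Variables (n : nat).
Variable mu : {sigma_finite_measure set (n.-tuple (measurableTypeR R)) -> \bar R}.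

Definition leb_cons : set (n.+1.-tuple (measurableTypeR R)) -> \bar R :=
  pushforward (lebesgue_measure \x mu) (@tcons n).

Let mpre A : measurable A -> measurable (@tcons n @^-1` A).
Proof. by move=> mA; rewrite -[X in measurable X]setTI; exact: measurable_tcons. Qed.

Let leb_cons0 : leb_cons set0 = 0.
Proof. by rewrite /leb_cons /pushforward preimage_set0 measure0. Qed.

Let leb_cons_ge0 A : 0 <= leb_cons A.
Proof. exact: (measure_ge0 (lebesgue_measure \x mu)). Qed.

Let leb_cons_sigma_additive : semi_sigma_additive leb_cons.
Proof.
move=> F mF tF mUF; rewrite /leb_cons /pushforward preimage_bigcup.
apply: measure_semi_sigma_additive.
- by move=> i; exact: mpre.
- apply/trivIsetP => /= i j _ _ ij; rewrite -preimage_setI.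
  by move/trivIsetP : tF => /(_ _ _ _ _ ij) ->//; rewrite preimage_set0.
- by rewrite -preimage_bigcup; exact: mpre.
Qed.

HB.instance Definition _ := isMeasure.Build _ _ _
  leb_cons leb_cons0 leb_cons_ge0 leb_cons_sigma_additive.

Let leb_cons_sigma_finite : sigma_finite setT leb_cons.
Proof.
have [F TF mF] : sigma_finite setT (lebesgue_measure \x mu).
  exact: (sigma_finiteT (sfprod lebesgue_measure mu)).
pose g (t : n.+1.-tuple (measurableTypeR R)) := (thead t, [tuple of behead t]).
have mg : measurable_fun setT g.
  by apply: measurable_fun_pair; [exact: measurable_tnth|exact: measurable_behead].
have gK : cancel (@tcons n) g.
  by move=> [a t]; congr pair; apply/val_inj.
exists (fun k => g @^-1` F k).
  by rewrite -preimage_bigcup -TF preimage_setT.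
move=> k; have [mFk Fk] := mF k; split.
  by rewrite -[X in measurable X]setTI; exact: mg.
rewrite /leb_cons /pushforward -comp_preimage.
by rewrite (_ : g \o _ = id)//; apply/funext => z /=; rewrite gK.
Qed.

HB.instance Definition _ := Measure_isSigmaFinite.Build _ _ _ leb_cons
  leb_cons_sigma_finite.
End step.

(* Lebesgue measure on R^n; for n = 0 it is the unit mass at the only point. *)
Fixpoint lebn n :
    {sigma_finite_measure set (n.-tuple (measurableTypeR R)) -> \bar R} :=
  if n is m.+1 then leb_cons (lebn m)
  else \d_([tuple] : 0.-tuple (measurableTypeR R)).

End tuple_lebesgue.

Section problem.
Context {R : realType}.

Definition leb_bdry N : {sigma_finite_measure set (bdry R N) -> \bar R} :=
  lebn N.-1.

Definition leb N : {sigma_finite_measure set (ambient R N) -> \bar R} :=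
  sfprod (leb_bdry N) lebesgue_measure.

Definition leb_time N :
    {sigma_finite_measure set (ambient R N * measurableTypeR R)%type -> \bar R} :=
  sfprod (leb N) lebesgue_measure.

Definition Omega N : set (ambient R N) := [set x | 0 < x.2].

Definition cOmega N : set (ambient R N) := [set x | 0 <= x.2].

Definition QT N (T : \bar R) : set (ambient R N * measurableTypeR R)%type :=
  [set z | 0 < z.1.2 /\ 0 < z.2 /\ (z.2%:E < T)%E].

Lemma measurable_Omega N : measurable (@Omega N).
Proof.
have -> : @Omega N = snd @^-1` `]0, +oo[%classic.
  by apply/seteqP; split => x /=; rewrite in_itv/= andbT.
by rewrite -[X in measurable X]setTI; exact: measurable_snd.
Qed.

Lemma measurable_cOmega N : measurable (@cOmega N).
Proof.
have -> : @cOmega N = snd @^-1` `[0, +oo[%classic.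
  by apply/seteqP; split => x /=; rewrite in_itv/= andbT.
by rewrite -[X in measurable X]setTI; exact: measurable_snd.
Qed.

Lemma measurable_QT N T : measurable (@QT N T).
Proof.
have -> : @QT N T = @Omega N `*` (`]0, +oo[ `&` EFin @^-1` `]-oo, T[)%classic.
  apply/seteqP; split => z /=; rewrite !in_itv/= andbT.
    by case=> ? [].
  by case=> ? [].
apply: measurableX; first exact: measurable_Omega.
apply: measurableI => //.
by rewrite -[X in measurable X]setTI; apply: EFin_measurable => //;
  exact: emeasurable_itv.
Qed.

(* Library measurability is Borel measurability; Lebesgue measurability on D
   (measurability for the completion of mu) amounts to agreeing almost
   everywhere on D with a Borel function. The library integral of a nonnegative
   function is a supremum over Borel simple functions below it, so it has the
   expected value on such functions too. *)
Definition lebesgue_measurable d d' (X : measurableType d)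
    (Y : sigmaRingType d') (mu : {measure set X -> \bar R})
    (D : set X) (g : X -> Y) :=
  exists2 g0 : X -> Y, measurable_fun D g0 & {ae mu, forall x, D x -> g x = g0 x}.

Definition in_L N (f : ambient R N -> R) :=
  (forall x, Omega x -> 0 <= f x) /\ lebesgue_measurable (leb N) (@Omega N) f.

Definition in_L' N (h : bdry R N -> R) :=
  (forall x', 0 <= h x') /\ lebesgue_measurable (leb_bdry N) setT h.

Definition in_LQ N T (u : (ambient R N * measurableTypeR R)%type -> \bar R) :=
  [/\ forall z, QT T z -> (0 <= u z)%E,
      lebesgue_measurable (leb_time N) (@QT N T) u &
      {ae leb_time N, forall z, QT T z -> (u z < +oo)%E}].

Definition sqdist' n (x y : n.-tuple (measurableTypeR R)) : R :=
  \sum_(i < n) (tnth x i - tnth y i : R) ^+ 2.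

Definition sqdist N (x y : ambient R N) : R :=
  sqdist' x.1 y.1 + (x.2 - y.2) ^+ 2.

(* Radon measures on the closed half-space, as Borel measures on the ambient
   space which do not charge the complement and are finite on bounded sets. *)
Definition in_M N (mu : {measure set (ambient R N) -> \bar R}) :=
  mu (~` @cOmega N) = 0%E /\
  forall (a : ambient R N) (r : R),
    (mu (@cOmega N `&` [set x | (sqdist a x <= r)%R]) < +oo)%E.

(* mu = x_N f + h(x') (x) delta_1(x_N) *)
Definition is_datum N (f : ambient R N -> R) (h : bdry R N -> R)
    (mu : {measure set (ambient R N) -> \bar R}) :=
  forall E, measurable E ->
    (mu E = \int[leb N]_(x in E `&` @Omega N) (x.2 * f x)%:E +
            \int[leb_bdry N]_(x' in [set x' | E (x', 0%R)]) (h x')%:E)%E.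

(* The Gaussian kernel of R^d, as a function of r2 = |x|^2. *)
Definition Gamma (d : nat) (r2 t : R) : R :=
  (4 * pi * t) `^ (- (d%:R / 2)) * expR (- (r2 / (4 * t))).

Definition G N (x y : ambient R N) (t : R) : R :=
  Gamma N (sqdist x y) t * (1 - expR (- (x.2 * y.2 / t))).

Definition K N (x y : ambient R N) (t : R) : R :=
  if 0 < y.2 then (y.2 : R)^-1 * G x y t
  else x.2 / t * Gamma N (sqdist x y) t.

Lemma K_bdryE N (x : ambient R N) (y' : bdry R N) (t : R) :
  K x (y', 0) t = derive1 (fun s : R => G x (y', s) t) 0.
Proof.
rewrite /K /= ltxx derive1E.
set q := sqdist' x.1 y'; pose a : R := x.2.
pose F (s : R) := Gamma N (q + (a - s) ^+ 2) t.
pose H (s : R) := 1 - expR (- (a * s / t)).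
have dH : is_derive (0 : R) (1 : R) H (a / t).
  have -> : H = cst 1 - (expR \o (fun s => - (a / t) * s)).
    by apply/funext => s; rewrite /H !fctE mulNr mulrAC.
  have dl : is_derive (0 : R) (1 : R) (fun s : R => - (a / t) * s) (- (a / t)).
    have -> : (fun s : R => - (a / t) * s) = - (a / t) \*: (id : R -> R).
      by apply/funext.
    by apply: is_derive_eq; rewrite /GRing.scale /= mulr1.
  apply: is_derive_eq.
  by rewrite /= mulr0 expR0 mul1r sub0r opprK.
have FE : F 0 = Gamma N (sqdist x (y', 0)) t by [].
have dF : derivable F (0 : R) 1.
  pose c := (4 * pi * t) `^ (- (N%:R / 2)).
  pose l : R -> R := cst a - id.
  have Fdec : F = cst c * (expR \o (- (4 * t)^-1 \*: (cst q + l ^+ 2))).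
    apply/funext => s; rewrite /F /Gamma -/c !fctE /=; congr (_ * expR _).
    by rewrite /GRing.scale /= mulNr mulrC.
  have dl : is_derive (0 : R) (1 : R) (- (4 * t)^-1 \*: (cst q + l ^+ 2))
    (- (4 * t)^-1 *: (0 + (2 *: l 0 ^+ 1) *: (0 - 1))).
    exact: is_derive_eq.
  by rewrite Fdec; apply: derivableM => //; apply: ex_derive.
have -> : (fun s : R => G x (y', s) t) = F * H by apply/funext.
rewrite deriveM// derive_val FE /H mulr0 mul0r oppr0 expR0 subrr scale0r addr0.
by rewrite /GRing.scale /= mulrC.
Qed.

Definition Gop N (t : R) (f : ambient R N -> R) (x : ambient R N) : \bar R :=
  (\int[leb N]_(y in @Omega N) (G x y t * f y)%:E)%E.

Definition Gammaop N (t : R) (h : bdry R N -> R) (x' : bdry R N) : \bar R :=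
  (\int[leb_bdry N]_y' (Gamma N.-1 (sqdist' x' y') t * h y')%:E)%E.

Definition solution N (p : R) (mu : {measure set (ambient R N) -> \bar R})
    (T : \bar R) (u : (ambient R N * measurableTypeR R)%type -> \bar R) :=
  in_LQ T u /\
  {ae leb_time N, forall z, QT T z ->
    (u z = \int[mu]_(y in @cOmega N) (K z.1 y z.2)%:E +
           \int[lebesgue_measure]_(s in `]0%R, z.2[)
             \int[leb N]_(y in @Omega N)
               ((G z.1 y (z.2 - s))%:E * u (y, s) `^ p))%E}.

Definition norm_Omega N (g : ambient R N -> R) : \bar R :=
  'N[leb N]_+oo[(EFin \o g) \_ (@Omega N)].

Definition norm_bdry N (g : bdry R N -> R) : \bar R :=
  'N[leb_bdry N]_+oo[EFin \o g].

Section Phi.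
Variable Phi : R -> R.

(* The inverse of Phi : [0, +oo) -> [0, +oo). *)
Definition Phi_inv : R -> R := 'pinv_(fun=> 0) `[0, +oo[%classic Phi.

Definition fA (p tau : R) : R := Phi_inv tau `^ p / tau.

Definition fB (tau : R) : R := tau / Phi_inv tau.

(* [fine] is only ever applied to values assumed to be finite. *)
Definition GPhi N (f : ambient R N -> R) t x : R := fine (Gop t (Phi \o f) x).

Definition GammaPhi N (h : bdry R N -> R) t x' : R :=
  fine (Gammaop t (Phi \o h) x').

Definition fv N (f : ambient R N -> R) (x : ambient R N) (t : R) : R :=
  2 * Phi_inv (GPhi f t x).

Definition fw N (h : bdry R N -> R) (x : ambient R N) (t : R) : R :=
  2 * (x.2 / t) * Gamma 1 (x.2 ^+ 2) t * Phi_inv (GammaPhi h t x.1).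

Definition small_f N (f : ambient R N -> R) (p : R) (T : \bar R) :=
  (ereal_sup [set norm_Omega (fun x => fB (GPhi f t x)) *
      \int[lebesgue_measure]_(s in `]0%R, t[)
        norm_Omega (fun x => fA p (GPhi f s x))
    | t in [set t : R | (0 < t)%R /\ t%:E < T]]
  <= (2 `^ (- (2 * p) + 1))%:E)%E.

Definition small_h N (h : bdry R N -> R) (p : R) (T : \bar R) :=
  (ereal_sup [set norm_bdry (fun x' => fB (GammaPhi h t x')) *
      \int[lebesgue_measure]_(s in `]0%R, t[)
        ((s `^ (- (p - 1)))%:E * norm_bdry (fun x' => fA p (GammaPhi h s x')))
    | t in [set t : R | (0 < t)%R /\ t%:E < T]]
  <= (2 `^ (- (2 * p) + 1) * (2 * expR 1 * pi) `^ ((p - 1) / 2))%:E)%E.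

End Phi.
End problem.

(* Main.v *)
Require Import Defs.
From mathcomp Require Import all_boot all_order all_algebra.
From mathcomp Require Import all_classical all_reals all_analysis.
From mathcomp Require Import measurable_realfun ess_sup_inf.
From mathcomp Require Import ring lra.

(** The function v + w is a supersolution of the integral equation, and monotone
    iteration from 0 gives a solution below it.

    One half of v + w bounds the linear term and the other half the Duhamel term.
    The linear term is
      int K dmu = G(t) f + (x_N / t) Gamma_1(x_N, t) Gamma_(N-1)(t) h
    [integral_K_datum]. Jensen's inequality G(t) f <= Phi^(-1)(G(t) Phi(f)), valid
    because G(t) has mass at most 1 and Phi(0) = 0, and the same inequality for
    Gamma_(N-1)(t) bound it by (v + w) / 2 [jensen_subprobability].

    For the Duhamel term, convexity gives (v + w)^p <= 2^(p-1) (v^p + w^p), and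
      v(s)^p = 2^p A(G(s) Phi(f)) G(s) Phi(f)
             <= 2^p ||A(G(s) Phi(f))||_oo G(s) Phi(f).
    The semigroup property G(t - s) G(s) = G(t) removes s from the last factor, and
    G(t) Phi(f) = B(G(t) Phi(f)) v(t) / 2, so that the first smallness condition
    bounds int_0^t G(t - s) v(s)^p ds by 2^(-p) v(t). The computation for w is the
    same with the boundary kernel (y_N / s) Gamma_1(y_N, s) Gamma_(N-1)(y' - z', s)
    in place of G; the power p - 1 of its factor depending on y_N is absorbed by
      (y_N / s) Gamma_1(y_N, s) <= (2 e pi)^(-1/2) s^(-1).
    Both computations are instances of [duhamel_power_le]. Altogether the Duhamel
    term is at most 2^(p-1) 2^(-p) (v + w) = (v + w) / 2.

    The semigroup property of G follows from the convolution of Gaussians by the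
    method of images [interior_kernel_semigroup]. For the boundary kernel the
    inequality <= is enough, and it is obtained from that of G by letting the pole
    approach the boundary [interior_boundary_kernel_le].

    The smallness conditions bound B for almost every x at each time t. Hence the
    supersolution inequality holds for every t and almost every x, then almost
    everywhere in Q_T by Tonelli's theorem, which is what the iteration of
    [exists_solution_below_supersolution] requires. *)

Set Implicit Arguments.
Unset Strict Implicit.
Unset Printing Implicit Defensive.

Import Order.TTheory GRing.Theory Num.Theory.
Import numFieldNormedType.Exports.

Local Open Scope classical_set_scope.
Local Open Scope ring_scope.

(** * Nonnegative integrals, null sets and monotone iteration *)
Section nonnegative_integrals.
Context d (X : measurableType d) (R : realType).
Variable m : {measure set X -> \bar R}.
Implicit Types (D : set X) (f g : X -> \bar R).
Import HBNNSimple.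
Local Open Scope ereal_scope.

(** The integral of a nonnegative function is the supremum of those of the simple
    functions below it, hence monotone without any measurability. This matters
    for functions of time such as s |-> ||A(G(s) Phi(f))||_oo, which need not be
    Borel a priori. *)
Lemma le_integral_ge0 D f g : (forall x, D x -> 0 <= f x) ->
  (forall x, D x -> f x <= g x) ->
  \int[m]_(x in D) f x <= \int[m]_(x in D) g x.
Proof.
move=> f0 fg.
have g0 x : D x -> 0 <= g x by move=> Dx; apply: le_trans (f0 _ Dx) (fg _ Dx).
rewrite !ge0_integralE//; apply: le_ereal_sup => _ [h /= hf <-].
exists h => // x; apply: (le_trans (hf x)); rewrite !patchE.
by case: ifPn => // /set_mem; exact: fg.
Qed.

(** Off a null set the same simple functions lie below f and below g. The data of
    the problem are only Lebesgue measurable; this lemma replaces them by Borel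
    representatives, for which Tonelli's theorem is available. *)
Lemma eq_integral_ae_measurable D f g : measurable D ->
  (forall x, D x -> 0 <= f x) -> (forall x, D x -> 0 <= g x) ->
  measurable_fun D g -> {ae m, forall x, D x -> f x = g x} ->
  \int[m]_(x in D) f x = \int[m]_(x in D) g x.
Proof.
move=> mD f0 g0 mg fg.
have [B [mB B0 fgB]] := fg.
have fgE x : D x -> ~ B x -> f x = g x.
  by move=> Dx /(subsetCl fgB) /= /(_ Dx).
apply/eqP; rewrite eq_le; apply/andP; split.
  rewrite ge0_integralE//; apply: ge_ereal_sup => _ [h /= hf <-].
  rewrite -integralT_nnsfun [leRHS]integral_mkcond.
  apply: ae_ge0_le_integral => //.
  - by move=> x _; rewrite lee_fin; exact: fun_ge0.
  - exact/measurable_EFinP/measurable_funP.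
  - by move=> x _; apply: erestrict_ge0.
  - exact/(measurable_restrictT _ _).1.
  - exists B; split=> // x /= hBx; apply: contrapT => Bx; apply: hBx => _.
    apply: (le_trans (hf x)); rewrite !patchE; case: ifPn => // /set_mem Dx.
    by rewrite fgE.
rewrite (ge0_negligible_integral mB)// integral_mkcond [leRHS]integral_mkcond.
apply: le_integral_ge0 => x _.
  by apply: erestrict_ge0 => y [Dy _]; exact: g0.
rewrite !patchE; case: ifPn => [/set_mem[Dx Bx]|_].
  by rewrite mem_set// fgE.
by case: ifPn => // /set_mem Dx; exact: f0.
Qed.

End nonnegative_integrals.

Section null_sets_of_products.
Context d1 d2 (X1 : measurableType d1) (X2 : measurableType d2) (R : realType).
Variables (m1 : {sigma_finite_measure set X1 -> \bar R}).
Variables (m2 : {sigma_finite_measure set X2 -> \bar R}).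
Local Open Scope ereal_scope.

(** Integrating the second variable last shows that a measurable set with null
    sections is null. The supersolution inequality is obtained for each t and
    almost every x; this makes it hold almost everywhere in space-time. *)
Lemma ae_sfprod_sections (P : X1 * X2 -> Prop) : measurable [set z | P z] ->
  (forall y, {ae m1, forall x, P (x, y)}) -> {ae sfprod m1 m2, forall z, P z}.
Proof.
move=> mP aeP; exists (~` [set z | P z]); split => //; first exact: measurableC.
have mCP : measurable (~` [set z | P z]) by exact: measurableC.
have -> : sfprod m1 m2 (~` [set z | P z]) = (m1 \x^ m2) (~` [set z | P z]).
  apply: product_measure_unique => // A B mA mB.
  exact: product_measure2E.
rewrite /product_measure2 integral0_eq// => y _ /=.
apply/negligibleP; first exact: measurable_ysection.
by apply: negligibleS (aeP y) => x /=; rewrite /ysection/= inE.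
Qed.

Lemma ae_sfprod_fst (P : X1 -> Prop) :
  {ae m1, forall x, P x} -> {ae sfprod m1 m2, forall z, P z.1}.
Proof.
move=> [B [mB B0 PB]]; exists (B `*` setT); split.
- exact: measurableX.
- transitivity (m1 B * m2 [set: X2]); first exact: product_measure1E.
  by have -> : m1 B = 0 by []; rewrite mul0e.
- by move=> z /= Pz; split => //; exact: PB.
Qed.

End null_sets_of_products.

Section monotone_iteration.
Context d (W : measurableType d) (R : realType).
Variable m : {sigma_finite_measure set W -> \bar R}.
Variables (k : W * W -> R) (U V : W -> \bar R) (p : R).
Hypotheses (k_ge0 : forall zw, 0 <= k zw) (mk : measurable_fun setT k).
Hypotheses (U_ge0 : forall z, (0 <= U z)%E) (mU : measurable_fun setT U).
Hypotheses (V_ge0 : forall z, (0 <= V z)%E) (mV : measurable_fun setT V).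
Hypothesis p_gt0 : 0 < p.
Local Open Scope ereal_scope.

Definition power_potential (u : W -> \bar R) (z : W) : \bar R :=
  \int[m]_w ((k (z, w))%:E * u w `^ p).

Let integrand_ge0 u z w : 0 <= (k (z, w))%:E * u w `^ p.
Proof. by rewrite mule_ge0// ?lee_fin// poweR_ge0. Qed.

Let poweR_le (a b : \bar R) : 0 <= a -> a <= b -> a `^ p <= b `^ p.
Proof.
move=> a0 ab; apply: gt0_ler_poweR => //; first exact: ltW.
- by rewrite in_itv/= a0 leey.
- by rewrite in_itv/= (le_trans a0 ab) leey.
Qed.

Let measurable_integrand u : measurable_fun setT u ->
  measurable_fun setT (fun zw : W * W => (k zw)%:E * u zw.2 `^ p).
Proof.
move=> mu; apply: emeasurable_funM; first exact/measurable_EFinP.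
apply: (measurableT_comp (measurable_poweR p)).
exact: measurableT_comp measurable_snd.
Qed.

Lemma measurable_power_potential u : measurable_fun setT u ->
  measurable_fun setT (power_potential u).
Proof.
move=> mu.
apply: (measurable_fun_fubini_tonelli_F (fun zw => (k zw)%:E * u zw.2 `^ p)).
  exact: measurable_integrand.
by move=> [z w]; exact: integrand_ge0.
Qed.

Let measurable_integrand2 u z : measurable_fun setT u ->
  measurable_fun setT (fun w => (k (z, w))%:E * u w `^ p).
Proof.
move=> mu; have := measurable_integrand mu.
by move=> /(measurable_fun_pair2 z); apply.
Qed.

Let potential_ge0 u z : 0 <= power_potential u z.
Proof. by apply: integral_ge0 => w _; exact: integrand_ge0. Qed.

Let picard n := iter n (fun u z => U z + power_potential u z) (cst 0).

Let picard_ge0 n z : 0 <= picard n z.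
Proof. by case: n => [|n] //=; rewrite adde_ge0. Qed.

Let measurable_picard n : measurable_fun setT (picard n).
Proof.
elim: n => [|n ih]; first exact: measurable_cst.
by apply: emeasurable_funD => //; exact: measurable_power_potential.
Qed.

Let picard_nd n z : picard n z <= picard n.+1 z.
Proof.
elim: n z => [|n ih] z; first exact: picard_ge0.
apply: leeD => //; apply: le_integral_ge0 => w _; first exact: integrand_ge0.
by rewrite lee_wpmul2l ?lee_fin//; exact: poweR_le.
Qed.

Let picard_homo z : {homo (fun n => picard n z) : a b / (a <= b)%N >-> a <= b}.
Proof. by apply/nondecreasing_seqP => n; exact: picard_nd. Qed.

Let sol z := ereal_sup (range (fun n => picard n z)).

Let picard_sol z : (fun n => picard n z) @ \oo --> sol z.
Proof. exact: ereal_nondecreasing_cvgn. Qed.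

Let picard_le_sol n z : picard n z <= sol z.
Proof. by apply: ereal_sup_ubound; exists n. Qed.

Let sol_ge0 z : 0 <= sol z.
Proof. by apply: le_trans (picard_le_sol 0 z). Qed.

(** Powers commute with suprema because x |-> x^(1/p) is an increasing inverse. *)
Let sol_poweR z :
  sol z `^ p = ereal_sup (range (fun n => picard n z `^ p)).
Proof.
apply/eqP; rewrite eq_le; apply/andP; split; last first.
  by apply: ge_ereal_sup => _ [n _ <-]; exact: poweR_le.
set L := ereal_sup _.
have L0 : 0 <= L.
  apply: (le_trans (poweR_ge0 (picard 0 z) p)).
  by apply: ereal_sup_ubound; exists 0%N.
have pK (x : \bar R) : 0 <= x -> (x `^ p) `^ p^-1 = x.
  by move=> x0; rewrite -poweRrM mulfV ?gt_eqF// poweRe1.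
have pVK (x : \bar R) : 0 <= x -> (x `^ p^-1) `^ p = x.
  by move=> x0; rewrite -poweRrM mulVf ?gt_eqF// poweRe1.
rewrite -[leRHS]pVK//; apply: poweR_le => //.
apply: ge_ereal_sup => _ [n _ <-]; rewrite -[leLHS]pK//.
apply: gt0_ler_poweR; rewrite ?in_itv/= ?leey ?andbT ?poweR_ge0//.
  by rewrite invr_ge0 ltW.
by apply: ereal_sup_ubound; exists n.
Qed.

Let sol_eq z : sol z = U z + power_potential sol z.
Proof.
have cvgP : (fun n => power_potential (picard n) z) @ \oo -->
            power_potential sol z.
  rewrite /power_potential.
  have -> : (\int[m]_w ((k (z, w))%:E * sol w `^ p)) =
    \int[m]_w (limn (fun n => (k (z, w))%:E * picard n w `^ p)).
    apply: eq_integral => w _; apply/esym/cvg_lim => //.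
    apply: cvgeZl => //; rewrite sol_poweR.
    apply: ereal_nondecreasing_cvgn => a b ab.
    by apply: poweR_le => //; exact: picard_homo.
  apply: cvg_monotone_convergence => //.
  - by move=> n; exact: measurable_integrand2.
  - by move=> w _ a b ab; rewrite lee_wpmul2l ?lee_fin//;
      apply: poweR_le => //; exact: picard_homo.
have h : (fun n => picard n.+1 z) @ \oo --> U z + power_potential sol z.
  apply: cvgeD => //; last exact: cvg_cst.
  by apply: ge0_adde_def; rewrite inE.
have h' : (fun n => picard n.+1 z) @ \oo --> sol z.
  by rewrite (cvg_shiftS (fun n => picard n z)).
exact: (cvg_unique _ h' h).
Qed.

(** The iterates of u |-> U + int k u^p starting from 0 increase, so that their
    supremum is a fixed point by monotone convergence. An inequality u <= V that
    holds almost everywhere becomes true everywhere after integration against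
    the kernel, which propagates the bound by V along the iteration. *)
Lemma exists_solution_below_supersolution :
  {ae m, forall z, U z + power_potential V z <= V z} ->
  exists u : W -> \bar R, [/\ measurable_fun setT u, forall z, 0 <= u z,
    forall z, u z = U z + power_potential u z &
    {ae m, forall z, u z <= V z}].
Proof.
move=> superV; exists sol; split => //.
- by apply: (emeasurable_fun_cvg picard) => // z _; exact: picard_sol.
- have picardV n : {ae m, forall z, picard n z <= V z}.
    elim: n => [|n ih]; first exact: aeW.
    apply: filterS superV => z; apply: le_trans; apply: leeD => //.
    apply: ae_ge0_le_integral => //; try exact: measurable_integrand2.
    apply: filterS ih => w ihw _.
    by rewrite lee_wpmul2l ?lee_fin//; exact: poweR_le.
  have /ae_foralln : forall n, {ae m, forall z, picard n z <= V z} by [].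
  apply: filterS => z allz; apply: ge_ereal_sup => _ [n _ <-]; exact: allz.
Qed.

End monotone_iteration.

(** * Gaussian kernels on the line *)
Section measurability_of_the_kernels.
Context {R : realType}.

Lemma measurable_invr : measurable_fun [set: R] (fun x : R => x^-1).
Proof.
have -> : (fun x : R => x^-1) =
    (fun x => if 0 <= x then x `^ (-1) else - ((- x) `^ (-1))).
  apply/funext => x; case: ifPn => [x0|]; first by rewrite powR_inv1.
  by rewrite -ltNge => x0; rewrite powR_inv1 ?invrN ?opprK// oppr_ge0 ltW.
apply: measurable_fun_ifT.
- exact: measurable_fun_ler.
- exact: measurable_powR.
- apply: measurable_funN.
  exact: (measurableT_comp (measurable_powR _)).
Qed.

Context d (X : measurableType d).
Implicit Types (r t : X -> R).

Lemma measurable_fun_div r t : measurable_fun setT r -> measurable_fun setT t ->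
  measurable_fun setT (fun z => r z / t z).
Proof.
by move=> mr mt; apply: measurable_funM => //; exact: (measurableT_comp measurable_invr).
Qed.

Lemma measurable_fun_Gamma n r t : measurable_fun setT r ->
  measurable_fun setT t -> measurable_fun setT (fun z => Gamma n (r z) (t z)).
Proof.
move=> mr mt; apply: measurable_funM.
  apply: (measurableT_comp (measurable_powR _)).
  exact: measurable_funM.
apply: (measurableT_comp (@measurable_expR R)); apply: measurable_funN.
by apply: measurable_fun_div => //; exact: measurable_funM.
Qed.

Lemma measurable_fun_sqdist' n (x y : X -> n.-tuple (measurableTypeR R)) :
  measurable_fun setT x -> measurable_fun setT y ->
  measurable_fun setT (fun z => sqdist' (x z) (y z)).
Proof.
move=> mx my; apply: measurable_sum => i; apply: measurable_funX.
apply: measurable_funB.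
  exact: (measurableT_comp (measurable_tnth i)).
exact: (measurableT_comp (measurable_tnth i)).
Qed.

Lemma measurable_fun_sqdist N (x y : X -> ambient R N) :
  measurable_fun setT x -> measurable_fun setT y ->
  measurable_fun setT (fun z => sqdist (x z) (y z)).
Proof.
move=> mx my; apply: measurable_funD.
  apply: measurable_fun_sqdist'.
    exact: (measurableT_comp measurable_fst).
  exact: (measurableT_comp measurable_fst).
apply: measurable_funX; apply: measurable_funB.
  exact: (measurableT_comp measurable_snd).
exact: (measurableT_comp measurable_snd).
Qed.

Lemma measurable_fun_G N (x y : X -> ambient R N) t :
  measurable_fun setT x -> measurable_fun setT y -> measurable_fun setT t ->
  measurable_fun setT (fun z => G (x z) (y z) (t z)).
Proof.
move=> mx my mt; apply: measurable_funM.
  by apply: measurable_fun_Gamma => //; exact: measurable_fun_sqdist.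
apply: measurable_funB => //.
apply: (measurableT_comp (@measurable_expR R)); apply: measurable_funN.
apply: measurable_fun_div => //; apply: measurable_funM.
  exact: (measurableT_comp measurable_snd).
exact: (measurableT_comp measurable_snd).
Qed.

End measurability_of_the_kernels.

Section gaussian.
Context {R : realType}.
Implicit Types (a b c q r s t : R).

Lemma Gamma_ge0 n r t : 0 <= Gamma n r t.
Proof. by rewrite mulr_ge0 ?powR_ge0 ?expR_ge0. Qed.

Lemma GammaD n q r t : 0 < t ->
  Gamma n.+1 (q + r) t = Gamma n q t * Gamma 1 r t.
Proof.
move=> t0; rewrite /Gamma mulrACA; congr (_ * _).
  rewrite -powRD; last first.
    by apply/implyP => _; rewrite gt_eqF// !mulr_gt0// pi_gt0.
  by congr (_ `^ _); rewrite -natr1; field.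
by rewrite -expRD mulrDl opprD.
Qed.

Lemma integral_Gamma1 a t : 0 < t ->
  (\int[lebesgue_measure]_b (Gamma 1 ((b - a) ^+ 2) t)%:E = 1)%E.
Proof.
move=> t0; pose sigma := Num.sqrt (2 * t).
have s2 : sigma ^+ 2 = 2 * t by rewrite sqr_sqrtr// mulr_ge0// ltW.
have s0 : sigma != 0 by rewrite sqrtr_eq0 -ltNge mulr_gt0.
rewrite -(integral_normal_pdf a sigma); apply: eq_integral => b _.
rewrite normal_pdfE// /normal_peak /normal_fun /Gamma s2; congr ((_ * expR _)%:E).
  have -> : 2 * t * pi *+ 2 = 4 * pi * t by ring.
  rewrite -powR12_sqrt ?mulr_ge0 ?pi_ge0// ?ltW// -powRN.
  by congr (_ `^ _); rewrite mul1r.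
by rewrite mulNr; congr (- (_ / _)); ring.
Qed.

(** Completing the square in b. *)
Lemma Gamma1_mul a b c s t : 0 < s -> 0 < t ->
  Gamma 1 ((a - b) ^+ 2) s * Gamma 1 ((b - c) ^+ 2) t =
  Gamma 1 ((a - c) ^+ 2) (s + t) *
  Gamma 1 ((b - (t * a + s * c) / (s + t)) ^+ 2) (s * t / (s + t)).
Proof.
move=> s0 t0; have st0 : 0 < s + t by rewrite addr_gt0.
rewrite /Gamma mulrACA [RHS]mulrACA -!expRD; congr (_ * expR _).
  rewrite -!powRM ?mulr_ge0 ?divr_ge0 ?pi_ge0 ?mulr_ge0 ?ltW ?invr_gt0//.
  by congr (_ `^ _); field; exact: lt0r_neq0.
by field; rewrite !lt0r_neq0.
Qed.

Lemma Gamma1_convolution a c s t : 0 < s -> 0 < t ->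
  (\int[lebesgue_measure]_b
     (Gamma 1 ((a - b) ^+ 2) s * Gamma 1 ((b - c) ^+ 2) t)%:E =
   (Gamma 1 ((a - c) ^+ 2) (s + t))%:E)%E.
Proof.
move=> s0 t0; have st0 : 0 < s + t by rewrite addr_gt0.
under eq_integral do rewrite Gamma1_mul// EFinM.
rewrite ge0_integralZl_EFin ?Gamma_ge0//.
- by rewrite integral_Gamma1 ?mule1// divr_gt0// mulr_gt0.
- by move=> b _; rewrite lee_fin Gamma_ge0.
- apply/measurable_EFinP; apply: measurable_fun_Gamma => //.
  by apply: measurable_funX; exact: measurable_funB.
Qed.

(** The derivative at b = 0 of the Dirichlet heat kernel of the half-line, seen
    from the point a at time t. *)
Definition normal_factor a t : R := a / t * Gamma 1 (a ^+ 2) t.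

Lemma normal_factor_ge0 a t : 0 <= a -> 0 < t -> 0 <= normal_factor a t.
Proof. by move=> a0 t0; rewrite mulr_ge0 ?Gamma_ge0// divr_ge0// ltW. Qed.

(** After squaring, and with u = a^2 / (2 s), this is the inequality
    u e^(-u) <= 1/e, an equality at a^2 = 2 s; hence the constant 2 e pi of the
    second smallness condition. *)
Lemma normal_factor_le s a : 0 < s -> 0 <= a ->
  normal_factor a s <= (2 * expR 1 * pi) `^ (- (1 / 2)) / s.
Proof.
move=> s0 a0; have p0 := pi_gt0 R.
have e0 : 0 < expR 1 :> R by exact: expR_gt0.
have half x : 0 <= x -> (x `^ (- (1%:R / 2))) ^+ 2 = x^-1 :> R.
  move=> x0; rewrite -powR_mulrn ?powR_ge0// -powRrM -[RHS]powR_inv1//.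
  by congr (_ `^ _); field.
set u := a ^+ 2 / (2 * s).
have uE : u * expR (- u) <= (expR 1)^-1.
  have -> : (expR 1)^-1 = expR ((-1 + u) + - u) by rewrite -expRN addrK.
  rewrite expRD ler_wpM2r ?expR_ge0// (le_trans _ (expR_ge1Dx _))//.
  by rewrite addrA subrr add0r.
rewrite /normal_factor; suff : (a / s * Gamma 1 (a ^+ 2) s) ^+ 2 <=
       ((2 * expR 1 * pi) `^ (- (1 / 2)) / s) ^+ 2.
  have L0 : 0 <= a / s * Gamma 1 (a ^+ 2) s by exact: normal_factor_ge0.
  have R0 : 0 <= (2 * expR 1 * pi) `^ (- (1 / 2)) / s.
    by rewrite divr_ge0 ?powR_ge0// ltW.
  by rewrite ler_pXn2r.
rewrite [leLHS]exprMn [leRHS]exprMn /Gamma [X in _ * X <= _]exprMn !half.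
- rewrite -expRM_natl.
  have -> : 2%:R * - (a ^+ 2 / (4 * s)) = - u.
    by rewrite /u; field; exact: lt0r_neq0.
  have -> : (a / s) ^+ 2 * ((4 * pi * s)^-1 * expR (- u)) =
            (2 * pi)^-1 * s^-1 ^+ 2 * (u * expR (- u)).
    by rewrite /u; move: (@pi R) p0 => q q0; field; rewrite !lt0r_neq0.
  have -> : (2 * expR 1 * pi)^-1 * s^-1 ^+ 2 =
            (2 * pi)^-1 * s^-1 ^+ 2 * (expR 1)^-1 :> R.
    by move: (@pi R) p0 => q q0; field; rewrite !lt0r_neq0.
  by rewrite ler_wpM2l// mulr_ge0 ?exprn_ge0 ?invr_ge0 ?mulr_ge0 ?ltW.
- by rewrite !mulr_ge0 ?ltW.
- by rewrite !mulr_ge0 ?ltW.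
Qed.
End gaussian.

(** * The Gaussian semigroup on R^n *)
Section integrals_of_products.
Context d1 d2 (X1 : measurableType d1) (X2 : measurableType d2) (R : realType).
Variables (m1 : {sigma_finite_measure set X1 -> \bar R}).
Variables (m2 : {sigma_finite_measure set X2 -> \bar R}).

Lemma integral_sfprod (f : X1 * X2 -> \bar R) : measurable_fun setT f ->
  (forall z, 0 <= f z)%E ->
  (\int[sfprod m1 m2]_z f z = \int[m1]_x \int[m2]_y f (x, y))%E.
Proof. by move=> mf f0; exact: fubini_tonelli1. Qed.

Lemma integral_sfprod_mul (f : X1 -> R) (g : X2 -> R) :
  measurable_fun setT f -> measurable_fun setT g ->
  (forall x, 0 <= f x) -> (forall y, 0 <= g y) ->
  (\int[sfprod m1 m2]_z (f z.1 * g z.2)%:E =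
   (\int[m1]_x (f x)%:E) * \int[m2]_y (g y)%:E)%E.
Proof.
move=> mf mg f0 g0; rewrite integral_sfprod/=; last 2 first.
- apply/measurable_EFinP; apply: measurable_funM.
    exact: (measurableT_comp mf measurable_fst).
  exact: (measurableT_comp mg measurable_snd).
- by move=> z; rewrite lee_fin mulr_ge0.
under eq_integral => x _.
  under eq_integral do rewrite EFinM.
  rewrite ge0_integralZl_EFin//; last 2 first.
  - by move=> y _; rewrite lee_fin.
  - exact/measurable_EFinP.
  over.
rewrite ge0_integralZr//.
- exact/measurable_EFinP.
- by move=> x _; rewrite lee_fin.
- by apply: integral_ge0 => y _; rewrite lee_fin.
Qed.

End integrals_of_products.

Section gaussian_semigroup.
Context {R : realType}.
Implicit Types (a b c q r s t : R).

Lemma integral_lebnS n (F : n.+1.-tuple (measurableTypeR R) -> \bar R) :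
  measurable_fun setT F -> (forall z, 0 <= F z)%E ->
  (\int[lebn n.+1]_z F z =
   \int[sfprod lebesgue_measure (lebn n)]_z F (tcons z))%E.
Proof.
move=> mF F0; rewrite [LHS](ge0_integral_pushforward (@measurable_tcons R n))//.
Qed.

Lemma sqdist'_tcons n (x : n.+1.-tuple (measurableTypeR R)) z :
  sqdist' x (tcons z) = sqdist' [tuple of behead x] z.2 + (thead x - z.1) ^+ 2.
Proof.
case/tupleP: x => x0 x; rewrite /sqdist' big_ord_recl addrC theadE.
congr (_ + _); apply: eq_bigr => i _.
rewrite /tcons !tnthS; congr ((tnth _ _ - _) ^+ 2).
exact: val_inj.
Qed.

Lemma sqdist'C n (x y : n.-tuple (measurableTypeR R)) : sqdist' x y = sqdist' y x.
Proof. by apply: eq_bigr => i _; rewrite -sqrrN opprB. Qed.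

Let measurable_Gamma_sqdist' n (x : n.-tuple (measurableTypeR R)) t :
  measurable_fun setT (fun y => Gamma n (sqdist' x y) t).
Proof.
by apply: measurable_fun_Gamma => //; exact: measurable_fun_sqdist'.
Qed.

Let measurable_Gamma_sqr a t :
  measurable_fun setT (fun b : measurableTypeR R => Gamma 1 ((a - b) ^+ 2) t).
Proof.
apply: measurable_fun_Gamma => //; apply: measurable_funX.
exact: measurable_funB.
Qed.

Lemma integral_Gamma_sqdist' n (x : n.-tuple (measurableTypeR R)) t : 0 < t ->
  (\int[lebn n]_y (Gamma n (sqdist' x y) t)%:E = 1)%E.
Proof.
move=> t0; elim: n x => [|n ih] x.
  rewrite integral_dirac// ?diracT ?mul1e.
    rewrite /Gamma /sqdist' big_ord0 !mul0r !oppr0 powRr0.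
    by rewrite expR0 mulr1.
  by apply/measurable_EFinP; exact: measurable_Gamma_sqdist'.
rewrite integral_lebnS//; last 2 first.
- by apply/measurable_EFinP; exact: measurable_Gamma_sqdist'.
- by move=> y; rewrite lee_fin Gamma_ge0.
under eq_integral do rewrite sqdist'_tcons GammaD// mulrC.
rewrite (integral_sfprod_mul lebesgue_measure (lebn n)
  (f := fun a => Gamma 1 ((thead x - a) ^+ 2) t)
  (g := fun y => Gamma n (sqdist' [tuple of behead x] y) t)); last 4 first.
- exact: measurable_Gamma_sqr.
- exact: measurable_Gamma_sqdist'.
- by move=> y; rewrite Gamma_ge0.
- by move=> y; rewrite Gamma_ge0.
rewrite ih mule1 -[RHS](integral_Gamma1 (thead x) t0).
by apply: eq_integral => b _; rewrite -sqrrN opprB.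
Qed.

(** The kernel of R^(n+1) factors over the head and the tail of a tuple, which
    reduces the identity to the one on the line. *)
Lemma Gamma_convolution n (x z : n.-tuple (measurableTypeR R)) s t :
  0 < s -> 0 < t ->
  (\int[lebn n]_y (Gamma n (sqdist' x y) s * Gamma n (sqdist' y z) t)%:E =
   (Gamma n (sqdist' x z) (s + t))%:E)%E.
Proof.
move=> s0 t0; under eq_integral do rewrite (sqdist'C _ z).
elim: n x z => [|n ih] x z.
  rewrite integral_dirac// ?diracT ?mul1e; last first.
    apply/measurable_EFinP; apply: measurable_funM; exact: measurable_Gamma_sqdist'.
  by rewrite /Gamma /sqdist' !big_ord0 !mul0r !oppr0 !powRr0 !expR0 !mulr1.
rewrite integral_lebnS//; last 2 first.
- apply/measurable_EFinP; apply: measurable_funM; exact: measurable_Gamma_sqdist'.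
- by move=> y; rewrite lee_fin mulr_ge0 ?Gamma_ge0.
under eq_integral => y _.
  rewrite !sqdist'_tcons !GammaD// mulrACA mulrC; over.
rewrite (integral_sfprod_mul lebesgue_measure (lebn n)
  (f := fun a => Gamma 1 ((thead x - a) ^+ 2) s * Gamma 1 ((thead z - a) ^+ 2) t)
  (g := fun y => Gamma n (sqdist' [tuple of behead x] y) s *
                 Gamma n (sqdist' [tuple of behead z] y) t)); last 4 first.
- apply: measurable_funM; exact: measurable_Gamma_sqr.
- apply: measurable_funM; exact: measurable_Gamma_sqdist'.
- by move=> y; rewrite mulr_ge0 ?Gamma_ge0.
- by move=> y; rewrite mulr_ge0 ?Gamma_ge0.
rewrite ih muleC; under eq_integral do rewrite -(sqrrN (thead z - _)) opprB.
rewrite Gamma1_convolution// -EFinM; congr (_%:E).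
rewrite -GammaD ?addr_gt0//; congr (Gamma _ _ _).
by case/tupleP: z => z0 z; have := sqdist'_tcons x (z0, z); rewrite theadE => ->;
  congr (sqdist' _ _ + _); exact: val_inj.
Qed.

End gaussian_semigroup.

(** * The Dirichlet heat kernel of the half-space *)
Section half_line.
Context {R : realType}.
Implicit Types (a b c q r s t : R).

Lemma integral_fold (f : R -> R) : measurable_fun setT f ->
  (forall b, 0 <= f b) ->
  (\int[lebesgue_measure]_(b in `]0%R, +oo[) (f b + f (- b))%:E =
   \int[lebesgue_measure]_b (f b)%:E)%E.
Proof.
move=> mf f0.
have mfN : measurable_fun setT (fun b => f (- b)) by exact: measurableT_comp.
have mE (g : R -> R) D : measurable_fun setT g -> measurable_fun D (EFin \o g).
  by move=> mg; apply/measurable_EFinP; exact: measurable_funTS.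
under eq_integral do rewrite EFinD.
rewrite ge0_integralD//; last 4 first.
- by move=> b _; rewrite lee_fin.
- exact: (mE f).
- by move=> b _; rewrite lee_fin.
- exact: (mE (fun b => f (- b))).
rewrite (integral_itv_obnd_cbnd (f := fun b => (f (- b))%:E)); last first.
  exact: (mE (fun b => f (- b))).
rewrite (ge0_integration_by_substitution0 (f := fun b => (f (- b))%:E)); last 2 first.
- exact: (mE (fun b => f (- b))).
- by move=> b; rewrite lee_fin.
under [X in (_ + X)%E]eq_integral do rewrite opprK.
rewrite addeC -ge0_integral_setU//; last 3 first.
- exact: (mE f).
- by move=> b _; rewrite lee_fin.
- apply/disj_setPS => b /=; rewrite !in_itv/= andbT => -[b0 b0'].
  by move: (lt_le_trans b0' b0); rewrite ltxx.
congr (integral _ _ _); apply/seteqP; split => // b _ /=.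
by rewrite !in_itv/= andbT; case: (leP b 0); [left|right].
Qed.

End half_line.

Section half_line_kernel.
Context {R : realType}.
Implicit Types (a b c q r s t : R).

Definition half_line_kernel a b t : R :=
  Gamma 1 ((a - b) ^+ 2) t * (1 - expR (- (a * b / t))).

(** The method of images. *)
Lemma half_line_kernelE a b t : 0 < t ->
  half_line_kernel a b t = Gamma 1 ((a - b) ^+ 2) t - Gamma 1 ((a + b) ^+ 2) t.
Proof.
move=> t0; rewrite /half_line_kernel mulrBr mulr1; congr (_ - _).
rewrite /Gamma -[LHS]mulrA -expRD; congr (_ * expR _); field; exact: lt0r_neq0.
Qed.

Lemma half_line_kernel_ge0 a b t : 0 <= a -> 0 <= b -> 0 < t ->
  0 <= half_line_kernel a b t.
Proof.
move=> a0 b0 t0; rewrite mulr_ge0 ?Gamma_ge0// subr_ge0 -[leRHS]expR0 ler_expR.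
by rewrite oppr_le0 divr_ge0 ?mulr_ge0// ltW.
Qed.

Lemma measurable_half_line_kernel_l a t :
  measurable_fun setT (fun b => half_line_kernel a b t).
Proof.
apply: measurable_funM.
  by apply: measurable_fun_Gamma => //; apply: measurable_funX; exact: measurable_funB.
apply: measurable_funB => //; apply: measurableT_comp => //.
by apply: measurable_funN; apply: measurable_funM => //; exact: measurable_funM.
Qed.

Lemma half_line_kernelC a b t : half_line_kernel a b t = half_line_kernel b a t.
Proof. by rewrite /half_line_kernel -sqrrN opprB (mulrC a). Qed.

(** With P, P' the Gaussians centred at a, c and M, M' their mirror images,
    (P - M)(P' - M') + (P M' + M P') = P P' + M M'. On the half-line each bracket
    is a nonnegative function folded over b |-> -b, so that its integral is a
    convolution on the whole line: the two give Gamma(a + c) and Gamma(a - c).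
    The identity is written without subtraction because the integrals take
    values in [0, +oo]. *)
Lemma half_line_kernel_convolution a c s t : 0 < a -> 0 < c -> 0 < s -> 0 < t ->
  (\int[lebesgue_measure]_(b in `]0%R, +oo[)
     (half_line_kernel a b s * half_line_kernel b c t)%:E =
   (half_line_kernel a c (s + t))%:E)%E.
Proof.
move=> a0 c0 s0 t0; have st0 : 0 < s + t by rewrite addr_gt0.
have mG e r q : measurable_fun setT (fun b => Gamma 1 ((e - b) ^+ 2) r) /\
    measurable_fun setT (fun b => Gamma 1 ((b - q) ^+ 2) r).
  by split; apply: measurable_fun_Gamma => //; apply: measurable_funX;
    exact: measurable_funB.
pose f e b := Gamma 1 ((a - b) ^+ 2) s * Gamma 1 ((b - e) ^+ 2) t.
have mf e : measurable_fun setT (f e).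
  by apply: measurable_funM; [exact: (mG _ _ 0).1|exact: (mG 0 _ _).2].
have f0 e b : 0 <= f e b by rewrite mulr_ge0 ?Gamma_ge0.
have mfN e : measurable_fun setT (fun b => f e b + f e (- b)).
  by apply: measurable_funD => //; apply: measurableT_comp => //.
have mh : measurable_fun setT
    (fun b => half_line_kernel a b s * half_line_kernel b c t).
  apply: measurable_funM; first exact: measurable_half_line_kernel_l.
  under eq_fun do rewrite half_line_kernelC.
  exact: measurable_half_line_kernel_l.
set I := (\int[_]_(_ in _) _)%E.
suff : (I + (Gamma 1 ((a + c) ^+ 2) (s + t))%:E =
        (Gamma 1 ((a - c) ^+ 2) (s + t))%:E)%E.
  rewrite half_line_kernelE//; case: I => //= r [<-].
  by rewrite addrK.
rewrite -[X in (a + X) ^+ 2]opprK -!Gamma1_convolution//.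
rewrite -[X in (_ + X)%E](integral_fold (mf (- c)) (f0 (- c))).
rewrite -[RHS](integral_fold (mf c) (f0 c)) /I -ge0_integralD//; last 4 first.
- move=> b; rewrite /= in_itv/= andbT => b0.
  rewrite lee_fin. by apply: mulr_ge0; apply: half_line_kernel_ge0 => //; exact: ltW.
- by apply/measurable_EFinP; exact: measurable_funTS.
- by move=> b _; rewrite lee_fin addr_ge0.
- by apply/measurable_EFinP; apply: measurable_funTS; exact: (mfN (- c)).
apply: eq_integral => b _; rewrite -EFinD; congr (_%:E).
rewrite !half_line_kernelE// /f !opprK.
rewrite -(sqrrN (- b - c)) opprD !opprK -(sqrrN (- b + c)) opprD opprK.
by ring.
Qed.

End half_line_kernel.

Section half_space_kernels.
Context {R : realType} (n : nat).
Local Notation space := (ambient R n.+1).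
Implicit Types (x y z : space) (s t : R).

(** Extending the kernels by 0 outside the open half-space and positive times
    makes them nonnegative Borel functions on the whole space, as Tonelli's
    theorem requires. *)
Definition interior_kernel x y t : R :=
  if [&& 0 < x.2, 0 < y.2 & 0 < t] then G x y t else 0.

(** K(x, (z', 0), t), extended by 0. *)
Definition boundary_kernel x (z' : bdry R n.+1) t : R :=
  if (0 < x.2) && (0 < t) then x.2 / t * Gamma n.+1 (sqdist x (z', 0)) t else 0.

Lemma G_split x y t : 0 < t ->
  G x y t = Gamma n (sqdist' x.1 y.1) t * half_line_kernel x.2 y.2 t.
Proof. by move=> t0; rewrite /G /sqdist GammaD// -mulrA. Qed.

Lemma G_ge0 x y t : 0 <= x.2 -> 0 <= y.2 -> 0 < t -> 0 <= G x y t.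
Proof.
by move=> *; rewrite G_split// mulr_ge0 ?Gamma_ge0// half_line_kernel_ge0.
Qed.

Lemma interior_kernel_ge0 x y t : 0 <= interior_kernel x y t.
Proof. by rewrite /interior_kernel; case: ifP => // /and3P[*]; rewrite G_ge0 ?ltW. Qed.

Lemma boundary_kernel_ge0 x (z' : bdry R n.+1) t : 0 <= boundary_kernel x z' t.
Proof.
rewrite /boundary_kernel; case: ifP => // /andP[x0 t0].
by rewrite mulr_ge0 ?Gamma_ge0// divr_ge0// ltW.
Qed.

Lemma measurable_fun_interior_kernel d (X : measurableType d)
    (x y : X -> space) (t : X -> R) :
  measurable_fun setT x -> measurable_fun setT y -> measurable_fun setT t ->
  measurable_fun setT (fun w => interior_kernel (x w) (y w) (t w)).
Proof.
move=> mx my mt; apply: measurable_fun_ifT => //; last exact: measurable_fun_G.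
apply: measurable_and; [|apply: measurable_and]; apply: measurable_fun_ltr => //.
- exact: (measurableT_comp measurable_snd).
- exact: (measurableT_comp measurable_snd).
Qed.

Lemma measurable_fun_boundary_kernel d (X : measurableType d) (x : X -> space)
    (z' : X -> bdry R n.+1) (t : X -> R) :
  measurable_fun setT x -> measurable_fun setT z' -> measurable_fun setT t ->
  measurable_fun setT (fun w => boundary_kernel (x w) (z' w) (t w)).
Proof.
move=> mx mz mt.
have mx2 : measurable_fun setT (fun w => (x w).2 : R).
  exact: (measurableT_comp measurable_snd).
apply: measurable_fun_ifT => //.
  by apply: measurable_and; exact: measurable_fun_ltr.
apply: measurable_funM; first exact: measurable_fun_div.
apply: measurable_fun_Gamma => //; apply: measurable_fun_sqdist => //.
exact: measurable_fun_pair.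
Qed.

Lemma boundary_kernel_split x (z' : bdry R n.+1) t : 0 < x.2 -> 0 < t ->
  boundary_kernel x z' t = normal_factor x.2 t * Gamma n (sqdist' x.1 z') t.
Proof.
rewrite /normal_factor.
move=> x0 t0; rewrite /boundary_kernel x0 t0 /= /sqdist /= subr0 GammaD//.
by rewrite -[RHS]mulrA [Gamma 1 _ _ * _]mulrC.
Qed.

Lemma interior_kernel_semigroup x z s t : 0 < s -> 0 < t ->
  (\int[leb n.+1]_y (interior_kernel x y s * interior_kernel y z t)%:E =
   (interior_kernel x z (s + t))%:E)%E.
Proof.
move=> s0 t0; have st0 : 0 < s + t by rewrite addr_gt0.
have [x0|x0] := ltP 0 (x.2 : R); last first.
  have G0 w r : interior_kernel x w r = 0 by rewrite /interior_kernel ltNge x0.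
  by rewrite G0 integral0_eq// => y _; rewrite G0 mul0r.
have [z0|z0] := ltP 0 (z.2 : R); last first.
  have G0 w r : interior_kernel w z r = 0.
    by rewrite /interior_kernel [0 < z.2]ltNge z0 /= andbF.
  by rewrite G0 integral0_eq// => y _; rewrite G0 mulr0.
rewrite [in RHS]/interior_kernel x0 z0 st0/= G_split//.
pose h (b : R) := half_line_kernel x.2 b s * half_line_kernel b z.2 t.
have mh : measurable_fun setT h.
  apply: measurable_funM; first exact: measurable_half_line_kernel_l.
  under eq_fun do rewrite half_line_kernelC.
  exact: measurable_half_line_kernel_l.
transitivity (\int[leb n.+1]_y
  ((Gamma n (sqdist' x.1 y.1) s * Gamma n (sqdist' y.1 z.1) t) *
   (if 0 < y.2 then h y.2 else 0))%:E)%E.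
  apply: eq_integral => y _; congr (_%:E).
  rewrite /interior_kernel x0 z0 s0 t0/= !andbT; case: ifPn => y0; last by rewrite !mulr0.
  by rewrite !G_split// /h mulrACA.
rewrite (integral_sfprod_mul (leb_bdry n.+1) lebesgue_measure
  (f := fun e => Gamma n (sqdist' x.1 e) s * Gamma n (sqdist' e z.1) t)
  (g := fun b => if 0 < b then h b else 0)); last 4 first.
- apply: measurable_funM; apply: measurable_fun_Gamma => //;
    exact: measurable_fun_sqdist'.
- by apply: measurable_fun_ifT => //; exact: measurable_fun_ltr.
- by move=> e; rewrite mulr_ge0 ?Gamma_ge0.
- move=> b; case: ifPn => // b0.
  by apply: mulr_ge0; apply: half_line_kernel_ge0 => //; exact: ltW.
rewrite Gamma_convolution// [in RHS]EFinM; congr (_ * _)%E.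
rewrite -half_line_kernel_convolution// [RHS]integral_mkcond.
apply: eq_integral => b _; rewrite patchE mem_setE in_itv/= andbT.
by case: ifPn.
Qed.

Lemma integral_interior_kernel_le1 x t :
  (\int[leb n.+1]_y (interior_kernel x y t)%:E <= 1)%E.
Proof.
have [t0|t0] := ltP 0 t; last first.
  rewrite integral0_eq//= => y _.
  by rewrite /interior_kernel [0 < t]ltNge t0 !andbF.
have := integral_Gamma1 (x.2 : R) t0.
have := integral_Gamma_sqdist' x.1 t0 => I1 I2.
rewrite -[leRHS]mule1 -[X in (X * _)%E]I1 -[X in (_ * X)%E]I2.
rewrite -(integral_sfprod_mul (leb_bdry n.+1) lebesgue_measure
  (f := fun e => Gamma n (sqdist' x.1 e) t)
  (g := fun b => Gamma 1 ((b - x.2) ^+ 2) t)); last 4 first.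
- by apply: measurable_fun_Gamma => //; exact: measurable_fun_sqdist'.
- by apply: measurable_fun_Gamma => //; apply: measurable_funX; exact: measurable_funB.
- by move=> e; rewrite Gamma_ge0.
- by move=> b; rewrite Gamma_ge0.
apply: le_integral_ge0 => y _; rewrite lee_fin ?interior_kernel_ge0//.
rewrite /interior_kernel; case: ifPn => [/and3P[x0 y0 _]|_]; last first.
  by rewrite mulr_ge0 ?Gamma_ge0.
rewrite G_split// ler_wpM2l ?Gamma_ge0// /half_line_kernel -sqrrN opprB.
by rewrite ler_piMr ?Gamma_ge0// gerBl expR_ge0.
Qed.

(** The boundary kernel is the limit of G(y, (z', c), t) / c as c tends to 0. This
    bound and the next one make it quantitative; they come from
    u e^(-u) <= 1 - e^(-u) <= u with u = y_N c / t. *)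
Lemma boundary_kernel_le_interior y (z' : bdry R n.+1) t c : 0 < c ->
  boundary_kernel y z' t * expR (- (c ^+ 2 / (4 * t) + y.2 * c / (2 * t))) <=
  c^-1 * interior_kernel y (z', c) t.
Proof.
move=> c0; rewrite /boundary_kernel /interior_kernel /= c0 /=.
case: ifPn => [/andP[y0 t0]|_]; last first.
  by rewrite mul0r mulr0.
rewrite /G /sqdist /= !GammaD// subr0.
set A := Gamma n _ t; set B := Gamma 1 _ t; set C := Gamma 1 _ t.
have -> : C = B * expR (- (c ^+ 2 / (4 * t)) + y.2 * c / (2 * t)).
  rewrite /B /C /Gamma -[RHS]mulrA -expRD; congr (_ * expR _).
  by field; exact: lt0r_neq0.
set u := y.2 * c / t.
have eu : u * expR (- u) <= 1 - expR (- u).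
  have -> : 1 - expR (- u) = (expR u - 1) * expR (- u).
    by rewrite mulrBl mul1r -expRD subrr expR0.
  by rewrite ler_wpM2r ?expR_ge0// lerBrDl expR_ge1Dx.
have -> : expR (- (c ^+ 2 / (4 * t) + y.2 * c / (2 * t))) =
    expR (- (c ^+ 2 / (4 * t)) + y.2 * c / (2 * t)) * expR (- u).
  by rewrite -expRD; congr expR; rewrite /u; field; exact: lt0r_neq0.
set E := expR (_ + _).
have -> : y.2 / t * (A * B) * (E * expR (- u)) =
          c^-1 * (A * (B * E)) * (u * expR (- u)).
  by rewrite /u; field; rewrite !lt0r_neq0.
have cV0 : 0 <= c^-1 by rewrite invr_ge0 ltW.
have A0 : 0 <= A by exact: Gamma_ge0.
have B0 : 0 <= B by exact: Gamma_ge0.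
have E0 : 0 <= E by exact: expR_ge0.
have ABE : 0 <= c^-1 * (A * (B * E)).
  exact: mulr_ge0 cV0 (mulr_ge0 A0 (mulr_ge0 B0 E0)).
rewrite [leRHS](_ : _ = c^-1 * (A * (B * E)) * (1 - expR (- u))); last by rewrite /u; ring.
by rewrite ler_wpM2l.
Qed.

Lemma interior_kernel_le_boundary x (z' : bdry R n.+1) t c : 0 < c ->
  c^-1 * interior_kernel x (z', c) t <= boundary_kernel x z' t * expR (x.2 * c / (2 * t)).
Proof.
move=> c0; rewrite /boundary_kernel /interior_kernel /= c0 /=.
case: ifPn => [/andP[x0 t0]|_]; last first.
  by rewrite mul0r mulr0.
rewrite /G /sqdist /= !GammaD// subr0.
set A := Gamma n _ t; set B := Gamma 1 _ t; set C := Gamma 1 _ t.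
have A0 : 0 <= A by exact: Gamma_ge0.
have B0 : 0 <= B by exact: Gamma_ge0.
have CB : B <= C * expR (x.2 * c / (2 * t)).
  rewrite /B /C /Gamma -[leRHS]mulrA -expRD ler_wpM2l ?powR_ge0// ler_expR.
  rewrite -subr_ge0 (_ : _ - _ = c ^+ 2 / (4 * t)).
    by rewrite divr_ge0 ?sqr_ge0// mulr_ge0// ltW.
  by field; exact: lt0r_neq0.
have eu : 1 - expR (- (x.2 * c / t)) <= x.2 * c / t.
  by rewrite lerBlDr -lerBlDl addrC (le_trans _ (expR_ge1Dx _))// addrC.
rewrite (le_trans (_ : _ <= c^-1 * (A * B * (x.2 * c / t))))//.
  rewrite ler_wpM2l ?invr_ge0 ?(ltW c0)// ler_wpM2l//.
  exact: mulr_ge0.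
rewrite (_ : c^-1 * _ = x.2 / t * A * B); last first.
  by field; rewrite !lt0r_neq0.
rewrite mulrA -[leRHS]mulrA ler_wpM2l//; apply: mulr_ge0 => //.
by rewrite divr_ge0// ltW.
Qed.

End half_space_kernels.

(** * Composition of kernels *)
Section boundary_semigroup.
Context {R : realType} (n : nat).
Local Notation space := (ambient R n.+1).

Let cvg_expR0 (u : nat -> R) :
  u @ \oo --> (0 : R) -> (fun k => expR (u k)) @ \oo --> (1 : R).
Proof.
move=> u0; rewrite -expR0; apply: (cvg_comp u expR u0).
exact: continuous_expR.
Qed.

(** The semigroup identity for the pole (z', c), divided by c, in the limit where c
    tends to 0. The exponential factor in the lower bound of the kernel increases
    to 1 along c = 1/(k+1), so that monotone convergence applies on the left; the
    factor in the upper bound tends to 1 on the right. *)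
Lemma interior_boundary_kernel_le (x : space) (z' : bdry R n.+1) (s t : R) :
  0 < s -> 0 < t ->
  (\int[leb n.+1]_y (interior_kernel x y s * boundary_kernel y z' t)%:E <=
   (boundary_kernel x z' (s + t))%:E)%E.
Proof.
move=> s0 t0; have st0 : 0 < s + t by rewrite addr_gt0.
pose c := @harmonic R.
have c0 k : 0 < c k by rewrite /c /= invr_gt0.
pose e k (y : space) := - (c k ^+ 2 / (4 * t) + y.2 * c k / (2 * t)).
pose g k (y : space) :=
  (interior_kernel x y s * (boundary_kernel y z' t * expR (e k y)))%:E.
have mg k : measurable_fun setT (g k).
  apply/measurable_EFinP; apply: measurable_funM; first exact: measurable_fun_interior_kernel.
  apply: measurable_funM; first exact: measurable_fun_boundary_kernel.
  apply: (measurableT_comp (@measurable_expR R)); apply: measurable_funN.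
  apply: measurable_funD => //; apply: measurable_funM => //.
  apply: measurable_funM => //; exact: measurable_snd.
have g0 k y : (0 <= g k y)%E.
  by rewrite lee_fin !mulr_ge0 ?interior_kernel_ge0 ?boundary_kernel_ge0 ?expR_ge0.
have g_nd y : {homo (fun k => g k y) : i j / (i <= j)%N >-> (i <= j)%E}.
  move=> i j ij; rewrite lee_fin ler_wpM2l ?interior_kernel_ge0//.
  rewrite /boundary_kernel; case: ifPn => [/andP[y0 _]|_]; last by rewrite !mul0r.
  have K0 : 0 <= y.2 / t * Gamma n.+1 (sqdist y (z', 0)) t.
    by rewrite mulr_ge0 ?Gamma_ge0// divr_ge0// ltW.
  rewrite ler_wpM2l//.
  have cij : c j <= c i.
    by rewrite /c /= lef_pV2 ?posrE ?ltr0n// ler_nat.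
  rewrite ler_expR lerN2 lerD// ler_pM2r ?invr_gt0 ?mulr_gt0//.
    by rewrite ler_pXn2r// nnegrE ltW.
  by rewrite ler_wpM2l// ltW.
have c_cvg : c @ \oo --> (0 : R) by exact: cvg_harmonic.
have exp_cvg (a b : R) :
    (fun k => expR (- (c k ^+ 2 / a + b * c k / (2 * t)))) @ \oo --> (1 : R).
  have : (fun k => - (c k ^+ 2 / a + b * c k / (2 * t))) @ \oo -->
      - (0 * 0 / a + b * 0 / (2 * t)).
    apply: cvgN; apply: cvgD; apply: cvgMr_tmp; last exact: cvgMl_tmp.
    exact: cvgM.
  by rewrite !mulr0 !mul0r addr0 oppr0; exact: cvg_expR0.
have g_cvg y : (fun k => g k y) @ \oo -->
    (interior_kernel x y s * boundary_kernel y z' t)%:E.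
  apply: cvg_EFin; first exact: nearW.
  apply: cvgMl_tmp; rewrite -[X in _ --> X]mulr1; apply: cvgMl_tmp.
  exact: exp_cvg.
have Ig_cvg : (fun k => \int[leb n.+1]_y g k y)%E @ \oo -->
              (\int[leb n.+1]_y (interior_kernel x y s * boundary_kernel y z' t)%:E)%E.
  under eq_integral => y _ do rewrite -(cvg_lim _ (g_cvg y))//.
  exact: cvg_monotone_convergence.
pose r k := (boundary_kernel x z' (s + t) * expR (x.2 * c k / (2 * (s + t))))%:E.
have r_cvg : r @ \oo --> (boundary_kernel x z' (s + t))%:E.
  apply: cvg_EFin; first exact: nearW.
  have : (fun k => x.2 * c k / (2 * (s + t))) @ \oo -->
      (x.2 : R) * 0 / (2 * (s + t)).
    by apply: cvgMr_tmp; exact: cvgMl_tmp.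
  rewrite !mulr0 !mul0r => /cvg_expR0 /cvgMl_tmp => /(_ (boundary_kernel x z' (s + t))).
  by rewrite mulr1.
apply: (lee_cvg_to Ig_cvg r_cvg); apply: nearW => k.
apply: (@le_trans _ _ ((c k)^-1 * interior_kernel x (z', c k) (s + t))%:E); last first.
  by rewrite lee_fin; exact: interior_kernel_le_boundary.
rewrite EFinM -interior_kernel_semigroup// -ge0_integralZl_EFin ?invr_ge0 ?(ltW (c0 k))//.
- apply: le_integral_ge0 => y _ //; rewrite -EFinM lee_fin [leRHS]mulrCA.
  by rewrite ler_wpM2l ?interior_kernel_ge0//; exact: boundary_kernel_le_interior.
- by move=> y _; rewrite lee_fin mulr_ge0 ?interior_kernel_ge0.
- by apply/measurable_EFinP; apply: measurable_funM; exact: measurable_fun_interior_kernel.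
Qed.

End boundary_semigroup.

Section composition_of_kernels.
Context d1 d2 (Y : measurableType d1) (Z : measurableType d2) (R : realType).
Variables (m1 : {sigma_finite_measure set Y -> \bar R}).
Variables (m2 : {sigma_finite_measure set Z -> \bar R}).
Local Open Scope ereal_scope.

Lemma kernel_composition_le (k1 : Y -> R) (k2 : Y * Z -> R) (k3 g : Z -> R) :
  measurable_fun setT k1 -> measurable_fun setT k2 -> measurable_fun setT g ->
  (forall y, 0 <= k1 y)%R -> (forall yz, 0 <= k2 yz)%R -> (forall z, 0 <= g z)%R ->
  (forall z, \int[m1]_y (k1 y * k2 (y, z))%:E <= (k3 z)%:E) ->
  \int[m1]_y ((k1 y)%:E * \int[m2]_z (k2 (y, z) * g z)%:E) <=
  \int[m2]_z (k3 z * g z)%:E.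
Proof.
move=> mk1 mk2 mg k10 k20 g0 k3_ub.
have mk2g : measurable_fun setT (fun yz => k2 yz * g yz.2)%R.
  by apply: measurable_funM => //; exact: (measurableT_comp mg measurable_snd).
have mF : measurable_fun setT (fun yz => (k1 yz.1 * (k2 yz * g yz.2))%:E).
  apply/measurable_EFinP; apply: measurable_funM => //.
  exact: (measurableT_comp mk1 measurable_fst).
rewrite (_ : (\int[m1]_y _) =
  \int[m1]_y \int[m2]_z (k1 y * (k2 (y, z) * g z))%:E); last first.
  apply: eq_integral => y _; under [RHS]eq_integral do rewrite EFinM.
  rewrite ge0_integralZl_EFin//.
  - by move=> z _; rewrite lee_fin mulr_ge0.
  - apply/measurable_EFinP.
    by have /(measurable_fun_pair2 y) := mk2g.
have F0 yz : 0 <= (k1 yz.1 * (k2 yz * g yz.2))%:E by rewrite lee_fin !mulr_ge0.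
rewrite (fubini_tonelli (fun yz => (k1 yz.1 * (k2 yz * g yz.2))%:E))//=.
apply: le_integral_ge0 => z _; first by apply: integral_ge0 => y _; exact: (F0 (y, z)).
under eq_integral do rewrite mulrA EFinM.
rewrite ge0_integralZr//.
- by rewrite EFinM lee_wpmul2r// lee_fin.
- apply/measurable_EFinP; apply: measurable_funM => //.
  by have /(measurable_fun_pair1 z) := mk2.
- by move=> y _; rewrite lee_fin mulr_ge0.
- by rewrite lee_fin.
Qed.

Lemma measurable_kernel_integral (k : Y * Z -> R) (g : Z -> R) :
  measurable_fun setT k -> measurable_fun setT g ->
  (forall yz, 0 <= k yz)%R -> (forall z, 0 <= g z)%R ->
  measurable_fun setT (fun y => \int[m2]_z (k (y, z) * g z)%:E).
Proof.
move=> mk mg k0 g0.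
apply: (measurable_fun_fubini_tonelli_F (fun yz => (k yz * g yz.2)%:E)).
  apply/measurable_EFinP; apply: measurable_funM => //.
  exact: (measurableT_comp mg measurable_snd).
by move=> yz; rewrite lee_fin mulr_ge0.
Qed.

End composition_of_kernels.

(** * The convex gauge and Jensen's inequality *)
Section convex_gauge.
Context {R : realType}.
Variable Phi : R -> R.
Hypothesis Phi_incr : {in `[0, +oo[ &, {homo Phi : x y / x < y}}.
Hypothesis Phi_ge0 : forall x, 0 <= x -> 0 <= Phi x.
Hypothesis Phi_convex : convex_function (`[0, +oo[%classic : set R) Phi.
Hypothesis Phi0 : Phi 0 = 0.

Lemma convex_gauge_le x y a : 0 <= x -> 0 <= y -> 0 <= a <= 1 ->
  Phi (a * x + (1 - a) * y) <= a * Phi x + (1 - a) * Phi y.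
Proof.
move=> x0 y0 a01.
have /andP[a0 a1] := a01.
have xD : x \in (`[0, +oo[%classic : set R) by rewrite inE/= in_itv/= x0.
have yD : y \in (`[0, +oo[%classic : set R) by rewrite inE/= in_itv/= y0.
have := Phi_convex (Itv01 a0 a1) xD yD.
by rewrite !convRE.
Qed.

Lemma gauge_lt x y : 0 <= x -> x < y -> Phi x < Phi y.
Proof.
move=> x0 xy; apply: Phi_incr => //; rewrite in_itv/= andbT//.
by rewrite (le_trans x0)// ltW.
Qed.

Lemma gauge_le x y : 0 <= x -> x <= y -> Phi x <= Phi y.
Proof.
by move=> x0; rewrite le_eqVlt => /predU1P[->//|/(gauge_lt x0)/ltW].
Qed.

(** A convex function is continuous in the interior of its domain, and this one is
    unbounded since Phi x >= x Phi 1 for x >= 1. The preimage of tau is the supremum b of the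
    sublevel set; convexity between b and b + 1 excludes a jump at b. *)
Lemma gauge_surj tau : 0 <= tau -> exists2 x, 0 <= x & Phi x = tau.
Proof.
rewrite le_eqVlt => /predU1P[<-|tau0]; first by exists 0.
have P1 : 0 < Phi 1 by rewrite -Phi0 gauge_lt.
pose S := [set x : R | 0 <= x /\ Phi x <= tau].
have S0 : S 0 by split => //; rewrite Phi0 ltW.
have Sub : ubound S (Num.max 1 (tau / Phi 1)).
  move=> x [x0 Px]; rewrite le_max; case: (leP x 1) => //= x1.
  rewrite ler_pdivlMr// (le_trans _ Px)//.
  have := @convex_gauge_le x 0 x^-1 x0 (lexx _).
  rewrite mulVf ?gt_eqF ?(lt_trans _ x1)// mulr0 addr0 Phi0 mulr0 addr0.
  rewrite invr_ge0 x0 invf_le1 ?(lt_trans _ x1)// (ltW x1) => /(_ isT).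
  by rewrite mulrC ler_pdivlMr ?(lt_trans _ x1)// mulrC.
have hS : has_sup S by split; [exists 0|exists (Num.max 1 (tau / Phi 1))].
set b := sup S.
have b0 : 0 <= b by apply: ub_le_sup => //; case: hS.
exists b => //; apply/eqP; rewrite eq_le.
apply/andP; split; rewrite leNgt; apply/negP => Pb.
  (* If Phi b > tau, write b as a convex combination, with a small weight a on
     b + 1, of b + 1 and a point x < b: as Phi x <= tau, Phi b comes out too
     small. *)
  have b_gt0 : 0 < b.
    by rewrite lt_neqAle b0 andbT; apply/eqP => b00; move: Pb; rewrite -b00 Phi0 ltNge ltW.
  set P := Phi (b + 1).
  have PbP : Phi b < P by apply: gauge_lt => //; rewrite ltrDl.
  have Ptau : 0 < P - tau by rewrite subr_gt0 (lt_trans Pb).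
  pose a := Num.min ((Phi b - tau) / (P - tau)) (b / (b + 1)) / 2.
  have m0 : 0 < Num.min ((Phi b - tau) / (P - tau)) (b / (b + 1)).
    rewrite lt_min; apply/andP; split; apply: divr_gt0 => //.
      by rewrite subr_gt0.
    by rewrite addr_gt0.
  have a0 : 0 < a by rewrite divr_gt0.
  have am : a < Num.min ((Phi b - tau) / (P - tau)) (b / (b + 1)).
    by rewrite /a ltr_pdivrMr// ltr_pMr// ltr1n.
  move: (am); rewrite lt_min => /andP[].
  rewrite ltr_pdivlMr// => a1; rewrite ltr_pdivlMr ?addr_gt0// => a2.
  have a_lt1 : a < 1.
    rewrite -(ltr_pM2r (_ : 0 < b + 1)) ?addr_gt0// (lt_trans a2)// mul1r.
    by rewrite ltrDl.
  pose x := (b - a * (b + 1)) / (1 - a).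
  have x0 : 0 <= x by rewrite divr_ge0// subr_ge0 ltW.
  have xb : x < b.
    by rewrite ltr_pdivrMr ?subr_gt0//; rewrite -subr_gt0; rewrite (_ : _ - _ = a)//; ring.
  have Px : Phi x <= tau.
    have bx : 0 < b - x by rewrite subr_gt0.
    have [y [y0 Py] xy] := sup_adherent bx hS.
    apply: le_trans (Py); apply: gauge_le => //; apply: ltW.
    by apply: le_lt_trans xy; rewrite subKr.
  have := @convex_gauge_le (b + 1) x a.
  rewrite addr_ge0// x0 (ltW a0) (ltW a_lt1) => /(_ isT isT isT).
  have -> : a * (b + 1) + (1 - a) * x = b.
    by rewrite /x; field; rewrite subr_eq0 gt_eqF.
  apply/negP; rewrite -ltNge -/P.
  apply: (@le_lt_trans _ _ (a * P + (1 - a) * tau)).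
    by rewrite lerD2l ler_wpM2l// subr_ge0 ltW.
  by rewrite mulrBl mul1r addrCA -mulrBr -ltrBrDl.
(* If Phi b < tau, convexity on [b, b + 1] keeps Phi below tau a little beyond b. *)
set P := Phi (b + 1).
have PbP : Phi b < P by apply: gauge_lt => //; rewrite ltrDl.
have D0 : 0 < P - Phi b by rewrite subr_gt0.
pose a := Num.min 1 ((tau - Phi b) / (P - Phi b)).
have a0 : 0 < a by rewrite lt_min ltr01 divr_gt0 ?subr_gt0.
have a1 : a <= 1 by rewrite ge_min lexx.
have aD : a * (P - Phi b) <= tau - Phi b by rewrite -ler_pdivlMr// ge_min lexx orbT.
have : S (b + a).
  split; first by rewrite addr_ge0// ltW.
  have := @convex_gauge_le (b + 1) b a.
  rewrite addr_ge0// b0 (ltW a0) a1 => /(_ isT isT isT).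
  have -> : a * (b + 1) + (1 - a) * b = b + a by ring.
  move=> /le_trans; apply; rewrite -/P.
  rewrite (_ : _ + _ = a * (P - Phi b) + Phi b); last by ring.
  by rewrite -lerBrDr.
move=> /(ub_le_sup (proj2 hS)); rewrite -/b leNgt; move/negP; apply.
by rewrite ltrDl.
Qed.

Lemma Phi_invK x : 0 <= x -> Phi_inv Phi (Phi x) = x.
Proof.
move=> x0; apply: pinvKV; last by rewrite inE/= in_itv/= x0.
move=> u v; rewrite !inE/= !in_itv/= !andbT => u0 v0 uv.
case: (ltgtP u v) => // [/(gauge_lt u0)|/(gauge_lt v0)].
  by rewrite uv ltxx.
by rewrite uv ltxx.
Qed.

Lemma Phi_inv_ge0 tau : 0 <= tau -> 0 <= Phi_inv Phi tau.
Proof. by move=> /gauge_surj[x x0 <-]; rewrite Phi_invK. Qed.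

Lemma Phi_invKV tau : 0 <= tau -> Phi (Phi_inv Phi tau) = tau.
Proof. by move=> /gauge_surj[x x0 <-]; rewrite Phi_invK. Qed.

Lemma Phi_inv0 : Phi_inv Phi 0 = 0.
Proof. by rewrite -{2}(Phi_invK (lexx 0)) Phi0. Qed.

Lemma Phi_inv_gt0 tau : 0 < tau -> 0 < Phi_inv Phi tau.
Proof.
move=> tau0; rewrite lt_neqAle Phi_inv_ge0 ?(ltW tau0)// andbT.
apply/eqP => i0; have := Phi_invKV (ltW tau0).
by rewrite -i0 Phi0 => t0; move: tau0; rewrite -t0 ltxx.
Qed.

Lemma Phi_inv_le s t : 0 <= s -> s <= t -> Phi_inv Phi s <= Phi_inv Phi t.
Proof.
move=> s0 st; rewrite leNgt; apply/negP => lt_inv.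
have := gauge_lt (Phi_inv_ge0 (le_trans s0 st)) lt_inv.
by rewrite !Phi_invKV// ?(le_trans s0)// ltNge st.
Qed.

Lemma measurable_gauge : measurable_fun setT (fun x : R => Phi (Num.max x 0)).
Proof.
apply: nondecreasing_measurable => // x y xy.
apply: gauge_le; first by rewrite le_max lexx orbT.
by rewrite ge_max !le_max xy lexx orbT.
Qed.

Lemma measurable_Phi_inv :
  measurable_fun setT (fun x : R => Phi_inv Phi (Num.max x 0)).
Proof.
apply: nondecreasing_measurable => // x y xy.
apply: Phi_inv_le; first by rewrite le_max lexx orbT.
by rewrite ge_max !le_max xy lexx orbT.
Qed.

(** The supremum of the slopes of the chords on the left of a is at most any slope
    on the right, and at least Phi a / a, which is positive. *)
Lemma supporting_line a : 0 < a ->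
  exists2 c, 0 < c & forall y, 0 <= y -> Phi a + c * (y - a) <= Phi y.
Proof.
move=> a0.
(* the slope of a chord to the left of a is at most that of one to the right *)
have slope z y : 0 <= z -> z < a -> a < y ->
    (Phi a - Phi z) / (a - z) <= (Phi y - Phi a) / (y - a).
  move=> z0 za ay; have zy := lt_trans za ay.
  rewrite ler_pdivrMr ?subr_gt0// mulrAC ler_pdivlMr ?subr_gt0//.
  pose l := (y - a) / (y - z).
  have l01 : 0 <= l <= 1.
    apply/andP; split; first by rewrite divr_ge0// subr_ge0 ltW.
    rewrite ler_pdivrMr ?subr_gt0// mul1r.
    by rewrite lerB// ltW.
  have := convex_gauge_le z0 (le_trans z0 (ltW zy)) l01.
  have -> : l * z + (1 - l) * y = a.
    by rewrite /l; field; rewrite subr_eq0 gt_eqF.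
  have -> : l * Phi z + (1 - l) * Phi y =
      ((y - a) * Phi z + (a - z) * Phi y) / (y - z).
    by rewrite /l; field; rewrite subr_eq0 gt_eqF.
  rewrite ler_pdivlMr ?subr_gt0// => ?; nra.
pose S := [set r | exists2 z, 0 <= z < a & r = (Phi a - Phi z) / (a - z)].
have S0 : S (Phi a / a) by exists 0; rewrite ?lexx ?a0// Phi0 !subr0.
have ubS y : a < y -> ubound S ((Phi y - Phi a) / (y - a)).
  by move=> ay _ [z /andP[z0 za] ->]; exact: slope.
have a1 : a < a + 1 by rewrite ltrDl.
have hS : has_sup S.
  split; first by exists (Phi a / a).
  by exists ((Phi (a + 1) - Phi a) / (a + 1 - a)); exact: ubS.
exists (sup S).
  apply: lt_le_trans (ub_le_sup (proj2 hS) S0).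
  by rewrite divr_gt0// -Phi0 gauge_lt.
move=> y y0; rewrite -lerBrDl; case: (ltgtP y a) => [ya|ay|->].
- rewrite -opprB mulrN lerNl opprB -ler_pdivrMr ?subr_gt0//.
  by apply: ub_le_sup; [exact: proj2 hS|exists y; rewrite // y0].
- rewrite -ler_pdivlMr ?subr_gt0//; apply: ge_sup; first exact: proj1 hS.
  exact: ubS.
- by rewrite !subrr mulr0.
Qed.

(** Solving the supporting line at a for f gives f <= b + Phi(f) / c with
    b = a - Phi a / c, and b >= 0 because the line passes below Phi 0 = 0. The
    sign of b is what allows a kernel of mass less than 1. *)
Lemma jensen_subprobability d (X : measurableType d)
    (m : {measure set X -> \bar R}) (k f : X -> R) (tau : R) :
  measurable_fun setT k -> measurable_fun setT f ->
  (forall x, 0 <= k x) -> (forall x, 0 <= f x) -> 0 <= tau ->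
  (\int[m]_x (k x)%:E <= 1)%E ->
  (\int[m]_x (k x * Phi (f x))%:E <= tau%:E)%E ->
  (\int[m]_x (k x * f x)%:E <= (Phi_inv Phi tau)%:E)%E.
Proof.
move=> mk mf k0 f0 tau0 k1 kPhi; apply/lee_addgt0Pr => e e0.
(* the line needs a positive abscissa, while Phi_inv tau = 0 when tau = 0 *)
rewrite -EFinD; set a := _ + e.
have a0 : 0 < a by rewrite ltr_wpDl// Phi_inv_ge0.
have taua : tau <= Phi a.
  rewrite -(Phi_invKV tau0); apply: gauge_le; first exact: Phi_inv_ge0.
  by rewrite lerDl ltW.
have [c c0 line] := supporting_line a0.
pose b := a - Phi a / c.
have b0 : 0 <= b.
  have := line 0 (lexx _); rewrite Phi0 sub0r mulrN subr_le0 mulrC => h.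
  by rewrite subr_ge0 ler_pdivrMr.
have mPhi : measurable_fun setT (fun x => Phi (f x)).
  rewrite (_ : (fun x => _) = (fun x => Phi (Num.max x 0)) \o f).
    exact: measurableT_comp measurable_gauge mf.
  by apply/funext => x /=; rewrite max_l.
apply: (@le_trans _ _ (\int[m]_x (b%:E * (k x)%:E + (c^-1)%:E * (k x * Phi (f x))%:E)))%E.
  apply: le_integral_ge0 => x _; first by rewrite lee_fin mulr_ge0.
  rewrite -!EFinM -EFinD lee_fin mulrCA (mulrC b) -mulrDr ler_wpM2l//.
  have := line (f x) (f0 x); rewrite -lerBrDl -ler_pdivlMl// lerBlDr => /le_trans; apply.
  by rewrite le_eqVlt; apply/orP; left; apply/eqP; rewrite /b; ring.
rewrite ge0_integralD//; last 4 first.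
- by move=> x _; rewrite -EFinM lee_fin mulr_ge0.
- by apply: emeasurable_funM => //; exact/measurable_EFinP.
- by move=> x _; rewrite -EFinM lee_fin mulr_ge0 ?invr_ge0 ?(ltW c0)// mulr_ge0// Phi_ge0.
- by apply: emeasurable_funM => //; apply/measurable_EFinP; exact: measurable_funM.
rewrite ge0_integralZl_EFin//; last 2 first.
- by move=> x _; rewrite lee_fin.
- exact/measurable_EFinP.
rewrite ge0_integralZl_EFin ?invr_ge0 ?(ltW c0)//; last 2 first.
- by move=> x _; rewrite lee_fin mulr_ge0// Phi_ge0.
- by apply/measurable_EFinP; exact: measurable_funM.
apply: (@le_trans _ _ (b%:E * 1 + (c^-1)%:E * (Phi a)%:E)%E).
  apply: leeD; apply: lee_wpmul2l; rewrite ?lee_fin ?invr_ge0 ?(ltW c0)//.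
  by rewrite (le_trans kPhi)// lee_fin.
by rewrite mule1 -EFinM -EFinD lee_fin /b mulrC subrK.
Qed.

End convex_gauge.

(** * Integration against the initial datum *)
Section integration_against_the_datum.
Context d d1 d2 (X : measurableType d) (X1 : measurableType d1)
  (X2 : measurableType d2) (R : realType).
Variables (mu : {measure set X -> \bar R}).
Variables (m1 : {measure set X1 -> \bar R}) (m2 : {measure set X2 -> \bar R}).
Variables (p1 : X1 -> X) (p2 : X2 -> X) (w1 : X1 -> R) (w2 : X2 -> R).
Hypotheses (mp1 : measurable_fun setT p1) (mp2 : measurable_fun setT p2).
Hypotheses (mw1 : measurable_fun setT w1) (mw2 : measurable_fun setT w2).
Hypotheses (w1_ge0 : forall x, 0 <= w1 x) (w2_ge0 : forall x, 0 <= w2 x).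
Hypothesis muE : forall E, measurable E ->
  (mu E = \int[m1]_x (\1_E (p1 x) * w1 x)%:E +
          \int[m2]_x (\1_E (p2 x) * w2 x)%:E)%E.
Local Open Scope ereal_scope.
Import HBNNSimple.

Let measurable_weighted (k : X -> R) : measurable_fun setT k ->
  measurable_fun setT (fun x => (k (p1 x) * w1 x)%:E) /\
  measurable_fun setT (fun x => (k (p2 x) * w2 x)%:E).
Proof.
by move=> mk; split; apply/measurable_EFinP; apply: measurable_funM => //;
  exact: measurableT_comp.
Qed.

Let integral_nnsfun_datum (s : {nnsfun X >-> R}) :
  \int[mu]_x (s x)%:E = \int[m1]_x (s (p1 x) * w1 x)%:E +
                        \int[m2]_x (s (p2 x) * w2 x)%:E.
Proof.
have s0 r : r \in range s -> (0 <= r)%R by rewrite inE => -[x _ <-].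
have sE x (w : R) : ((s x * w)%:E =
    \sum_(r \in range s) (r * (\1_(s @^-1` [set r]) x * w))%:E)%E.
  rewrite fsumEFin// [s x]fimfunE mulr_fsuml; congr (_%:E).
  by apply: eq_fsbigr => r _; rewrite mulrA.
have term_ge0 r x (w : R) : (0 <= w)%R ->
    (0 <= r * (\1_(s @^-1` [set r]) x * w))%R.
  move=> w0; have [r0|r0] := leP 0%R r; first by rewrite !mulr_ge0.
  by rewrite preimage_nnfun0// indic0 mul0r mulr0.
have m1E r : measurable_fun setT
    (fun x => (\1_(s @^-1` [set r]) (p1 x) * w1 x)%:E).
  exact: (measurable_weighted (measurable_indic _)).1.
have m2E r : measurable_fun setT
    (fun x => (\1_(s @^-1` [set r]) (p2 x) * w2 x)%:E).
  exact: (measurable_weighted (measurable_indic _)).2.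
have I1_ge0 r : 0 <= \int[m1]_x (\1_(s @^-1` [set r]) (p1 x) * w1 x)%:E.
  by apply: integral_ge0 => x _; rewrite lee_fin mulr_ge0.
have I2_ge0 r : 0 <= \int[m2]_x (\1_(s @^-1` [set r]) (p2 x) * w2 x)%:E.
  by apply: integral_ge0 => x _; rewrite lee_fin mulr_ge0.
have split_integral d' (Y : measurableType d') (m : {measure set Y -> \bar R})
    (q : Y -> X) (w : Y -> R) :
    (forall r, measurable_fun setT (fun x => (\1_(s @^-1` [set r]) (q x) * w x)%:E)) ->
    (forall y, 0 <= w y)%R ->
    \int[m]_x (s (q x) * w x)%:E = \sum_(r \in range s)
      r%:E * \int[m]_x (\1_(s @^-1` [set r]) (q x) * w x)%:E.
  move=> mE w0; under eq_integral do rewrite sE.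
  rewrite ge0_integral_fsum//; last 2 first.
  - move=> r; apply/measurable_EFinP; apply: measurable_funM => //.
    exact/measurable_EFinP/mE.
  - by move=> r x _; rewrite lee_fin term_ge0.
  apply: eq_fsbigr => r /s0 r0; under eq_integral do rewrite EFinM.
  rewrite ge0_integralZl_EFin//.
  by move=> x _; rewrite lee_fin mulr_ge0.
rewrite (split_integral _ _ m1)// (split_integral _ _ m2)// -fsbig_split//=.
rewrite integralT_nnsfun sintegralE.
apply: eq_fsbigr => r /s0 r0.
by rewrite muE// ge0_muleDr.
Qed.

(** The description of mu on sets extends to simple functions by linearity, and to
    nonnegative functions by monotone approximation. *)
Lemma integral_datum (k : X -> R) : measurable_fun setT k ->
  (forall x, 0 <= k x)%R ->
  \int[mu]_x (k x)%:E = \int[m1]_x (k (p1 x) * w1 x)%:E +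
                        \int[m2]_x (k (p2 x) * w2 x)%:E.
Proof.
move=> mk k0.
pose s := nnsfun_approx measurableT ((measurable_EFinP _ _).2 mk).
have s_cvg x : (fun n => (s n x)%:E) @ \oo --> (k x)%:E.
  by apply: cvg_nnsfun_approx => // y _; rewrite lee_fin.
have s_nd x : {homo (fun n => s n x) : a b / (a <= b)%N >-> (a <= b)%R}.
  by move=> a b ab; exact/lefP/nd_nnsfun_approx.
have cvg_w d' (Y : measurableType d') (m : {measure set Y -> \bar R})
    (q : Y -> X) (w : Y -> R) : measurable_fun setT q -> measurable_fun setT w ->
    (forall y, 0 <= w y)%R ->
    (fun n => \int[m]_y (s n (q y) * w y)%:E) @ \oo -->
    \int[m]_y (k (q y) * w y)%:E.
  move=> mq mw w0.
  have -> : \int[m]_y (k (q y) * w y)%:E =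
      \int[m]_y limn (fun n => (s n (q y) * w y)%:E).
    apply: eq_integral => y _; apply/esym/cvg_lim => //.
    under eq_fun do rewrite EFinM; rewrite EFinM.
    exact: cvgeZr.
  apply: cvg_monotone_convergence => //.
  - move=> n; apply/measurable_EFinP; apply: measurable_funM => //.
    exact: measurableT_comp.
  - by move=> n y _; rewrite lee_fin mulr_ge0.
  - by move=> y _ a b ab; rewrite lee_fin ler_wpM2r//; exact: s_nd.
have := cvg_w _ _ mu id (cst 1%R) (@measurable_id _ _ _)
  (@measurable_cst _ _ _ _ _ _) (fun=> ler01).
under eq_fun do under eq_integral do rewrite mulr1.
under eq_fun do rewrite integral_nnsfun_datum.
under eq_integral do rewrite mulr1.
move=> h; apply: (cvg_unique _ h) => //.
apply: cvgeD; [|exact: cvg_w|exact: cvg_w].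
by apply: ge0_adde_def; rewrite inE; apply: integral_ge0 => x _;
  rewrite lee_fin mulr_ge0.
Qed.

End integration_against_the_datum.

(** * Potentials of interior and boundary data *)
Section potentials.
Context {R : realType} (n : nat).
Local Notation space := (ambient R n.+1).
Local Notation boundary := (bdry R n.+1).
Local Open Scope ereal_scope.

Definition interior_potential (g : space -> R) (z : space * measurableTypeR R) :=
  \int[leb n.+1]_y (interior_kernel z.1 y z.2 * g y)%:E.

Definition boundary_potential (g : boundary -> R) (z : space * measurableTypeR R) :=
  \int[leb_bdry n.+1]_e (boundary_kernel z.1 e z.2 * g e)%:E.

Definition heat_potential (g : boundary -> R) (z : boundary * measurableTypeR R) :=
  \int[leb_bdry n.+1]_e (Gamma n (sqdist' z.1 e) z.2 * g e)%:E.

Section interior.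
Variable g : space -> R.
Hypotheses (mg : measurable_fun setT g) (g_ge0 : forall y, (0 <= g y)%R).

Lemma interior_potential_ge0 z : 0 <= interior_potential g z.
Proof. by apply: integral_ge0 => y _; rewrite lee_fin mulr_ge0 ?interior_kernel_ge0. Qed.

Lemma measurable_interior_potential : measurable_fun setT (interior_potential g).
Proof.
apply: (measurable_kernel_integral (leb n.+1)
  (k := fun zy => interior_kernel zy.1.1 zy.2 zy.1.2)) => //.
- apply: measurable_fun_interior_kernel.
  + exact: (measurableT_comp measurable_fst measurable_fst).
  + exact: measurable_snd.
  + exact: (measurableT_comp measurable_snd measurable_fst).
- by move=> ?; exact: interior_kernel_ge0.
Qed.

Lemma interior_potential_semigroup x s t : (0 < s)%R -> (s < t)%R ->
  \int[leb n.+1]_y ((interior_kernel x y (t - s))%:E * interior_potential g (y, s)) <=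
  interior_potential g (x, t).
Proof.
rewrite /interior_potential => s0 st.
apply: (@kernel_composition_le _ _ _ _ _ (leb n.+1) (leb n.+1)
  (fun y => interior_kernel x y (t - s)) (fun yz => interior_kernel yz.1 yz.2 s)
  (fun y => interior_kernel x y t) g) => //.
- exact: measurable_fun_interior_kernel.
- exact: measurable_fun_interior_kernel.
- by move=> y; exact: interior_kernel_ge0.
- by move=> ?; exact: interior_kernel_ge0.
- by move=> z; rewrite interior_kernel_semigroup// ?subr_gt0// subrK.
Qed.

End interior.

Section on_the_boundary.
Variable g : boundary -> R.
Hypotheses (mg : measurable_fun setT g) (g_ge0 : forall e, (0 <= g e)%R).

Lemma boundary_potential_ge0 z : 0 <= boundary_potential g z.
Proof. by apply: integral_ge0 => y _; rewrite lee_fin mulr_ge0 ?boundary_kernel_ge0. Qed.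

Lemma heat_potential_ge0 z : 0 <= heat_potential g z.
Proof. by apply: integral_ge0 => y _; rewrite lee_fin mulr_ge0 ?Gamma_ge0. Qed.

Lemma measurable_boundary_potential : measurable_fun setT (boundary_potential g).
Proof.
apply: (measurable_kernel_integral (leb_bdry n.+1)
  (k := fun zy => boundary_kernel zy.1.1 zy.2 zy.1.2)) => //.
- apply: measurable_fun_boundary_kernel.
  + exact: (measurableT_comp measurable_fst measurable_fst).
  + exact: measurable_snd.
  + exact: (measurableT_comp measurable_snd measurable_fst).
- by move=> ?; exact: boundary_kernel_ge0.
Qed.

Lemma measurable_heat_potential : measurable_fun setT (heat_potential g).
Proof.
apply: (measurable_kernel_integral (leb_bdry n.+1)
  (k := fun zy => Gamma n (sqdist' zy.1.1 zy.2) zy.1.2)) => //.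
- apply: measurable_fun_Gamma; first apply: measurable_fun_sqdist'.
  + exact: (measurableT_comp measurable_fst measurable_fst).
  + exact: measurable_snd.
  + exact: (measurableT_comp measurable_snd measurable_fst).
- by move=> ?; exact: Gamma_ge0.
Qed.

(** For a pole on the boundary the kernel of the half-space splits into a tangential
    Gaussian and a factor depending on x_N alone. *)
Lemma boundary_potentialE x t : (0 < x.2)%R -> (0 < t)%R ->
  boundary_potential g (x, t) =
  (normal_factor x.2 t)%:E * heat_potential g (x.1, t).
Proof.
move=> x0 t0; rewrite /boundary_potential.
under eq_integral do rewrite /= boundary_kernel_split// -mulrA EFinM.
rewrite ge0_integralZl_EFin//.
- by move=> e _; rewrite lee_fin mulr_ge0 ?Gamma_ge0.
- apply/measurable_EFinP; apply: measurable_funM => //.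
  by apply: measurable_fun_Gamma => //; exact: measurable_fun_sqdist'.
- by rewrite normal_factor_ge0// ltW.
Qed.

Lemma boundary_potential_semigroup x s t : (0 < s)%R -> (s < t)%R ->
  \int[leb n.+1]_y ((interior_kernel x y (t - s))%:E * boundary_potential g (y, s)) <=
  boundary_potential g (x, t).
Proof.
rewrite /boundary_potential => s0 st.
apply: (@kernel_composition_le _ _ _ _ _ (leb n.+1) (leb_bdry n.+1)
  (fun y => interior_kernel x y (t - s)) (fun yz => boundary_kernel yz.1 yz.2 s)
  (fun e => boundary_kernel x e t) g) => //.
- exact: measurable_fun_interior_kernel.
- exact: measurable_fun_boundary_kernel.
- by move=> y; exact: interior_kernel_ge0.
- by move=> ?; exact: boundary_kernel_ge0.
- move=> e; have := @interior_boundary_kernel_le R n x e (t - s) s.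
  by rewrite subr_gt0 st s0 subrK; apply.
Qed.

End on_the_boundary.

End potentials.

Section borel_representatives.
Context {R : realType} (n : nat).
Local Notation space := (ambient R n.+1).
Local Notation boundary := (bdry R n.+1).

Lemma in_L_borel (f : space -> R) : in_L f ->
  exists f1 : space -> R, [/\ measurable_fun setT f1, forall y, 0 <= f1 y &
    {ae leb n.+1, forall y, Omega y -> f y = f1 y}].
Proof.
move=> [f0 [g mg fg]].
exists (fun y => Num.max ((g \_ (@Omega R n.+1)) y) 0); split.
- apply: measurable_maxr => //.
  by apply/(measurable_restrictT _ _).1 => //; exact: measurable_Omega.
- by move=> y; rewrite le_max lexx orbT.
- apply: filterS fg => y fgy Oy; rewrite patchE mem_set// -fgy// max_l//.
  exact: f0.
Qed.

Lemma in_L'_borel (h : boundary -> R) : in_L' h ->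
  exists h1 : boundary -> R, [/\ measurable_fun setT h1, forall e, 0 <= h1 e &
    {ae leb_bdry n.+1, forall e, h e = h1 e}].
Proof.
move=> [h0 [g mg hg]]; exists (fun e => Num.max (g e) 0); split.
- exact: measurable_maxr.
- by move=> e; rewrite le_max lexx orbT.
- by apply: filterS hg => e hge; rewrite -hge// max_l.
Qed.

Variables (f f1 : space -> R) (h h1 : boundary -> R).
Hypotheses (f_ge0 : forall y, Omega y -> 0 <= f y).
Hypotheses (mf1 : measurable_fun setT f1) (f1_ge0 : forall y, 0 <= f1 y).
Hypothesis ff1 : {ae leb n.+1, forall y, Omega y -> f y = f1 y}.
Hypotheses (h_ge0 : forall e, 0 <= h e).
Hypotheses (mh1 : measurable_fun setT h1) (h1_ge0 : forall e, 0 <= h1 e).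
Hypothesis hh1 : {ae leb_bdry n.+1, forall e, h e = h1 e}.
Local Open Scope ereal_scope.

Lemma Gop_interior_potential (phi : R -> R) x t :
  measurable_fun setT (phi \o f1) -> (forall y, 0 <= y -> 0 <= phi y)%R ->
  Omega x -> (0 < t)%R ->
  Gop t (phi \o f) x = interior_potential (phi \o f1) (x, t).
Proof.
move=> mphi phi0 Ox t0; rewrite /Gop.
rewrite (@eq_integral_ae_measurable _ _ _ _ _ _
  (fun y => (G x y t * (phi \o f1) y)%:E)).
- rewrite integral_mkcond; apply: eq_integral => y _.
  rewrite patchE /interior_kernel /= Ox t0 andbT.
  have -> : (y \in @Omega R n.+1) = (0 < y.2)%R by apply/idP/idP; rewrite inE.
  by case: ifPn => //; rewrite mul0r.
- exact: measurable_Omega.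
- by move=> y Oy; rewrite lee_fin mulr_ge0 ?G_ge0 ?(ltW Ox) ?(ltW Oy)// phi0// f_ge0.
- by move=> y Oy; rewrite lee_fin mulr_ge0 ?G_ge0 ?(ltW Ox) ?(ltW Oy)// phi0.
- apply/measurable_EFinP; apply: measurable_funTS; apply: measurable_funM => //.
  exact: measurable_fun_G.
- by apply: filterS ff1 => y fy Oy /=; rewrite fy.
Qed.

Lemma Gammaop_heat_potential (phi : R -> R) e t :
  measurable_fun setT (phi \o h1) -> (forall y, 0 <= y -> 0 <= phi y)%R ->
  Gammaop t (phi \o h) e = heat_potential (phi \o h1) (e, t).
Proof.
move=> mphi phi0; rewrite /Gammaop.
apply: (@eq_integral_ae_measurable _ _ _ (leb_bdry n.+1)) => //.
- by move=> e' _; rewrite lee_fin mulr_ge0 ?Gamma_ge0// phi0.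
- by move=> e' _; rewrite lee_fin mulr_ge0 ?Gamma_ge0// phi0.
- apply/measurable_EFinP; apply: measurable_funM => //.
  by apply: measurable_fun_Gamma => //; exact: measurable_fun_sqdist'.
- by apply: filterS hh1 => e' he _ /=; rewrite he.
Qed.

(** The factor y_N^(-1) of K cancels the weight y_N of the interior part of the
    datum; on the boundary part K is the boundary kernel. *)
Lemma integral_K_datum (mu : {measure set space -> \bar R}) x t :
  is_datum f h mu -> Omega x -> (0 < t)%R ->
  \int[mu]_(y in @cOmega R n.+1) (K x y t)%:E =
  interior_potential f1 (x, t) + boundary_potential h1 (x, t).
Proof.
move=> hmu Ox t0.
have OE (y : space) : (y \in @Omega R n.+1) = (0 < y.2)%R by apply/idP/idP; rewrite inE.
pose w (y : space) : R := if (0 < y.2)%R then (y.2 * f1 y)%R else 0%R.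
have my2 : measurable_fun setT (fun y : space => y.2 : R) by exact: measurable_snd.
have mw : measurable_fun setT w.
  apply: measurable_fun_ifT => //; first exact: measurable_fun_ltr.
  exact: measurable_funM.
have w0 y : (0 <= w y)%R by rewrite /w; case: ifPn => // y0; rewrite mulr_ge0// ltW.
pose k (y : space) : R := if (0 <= y.2)%R then K x y t else 0%R.
have mk : measurable_fun setT k.
  apply: measurable_fun_ifT => //; first exact: measurable_fun_ler.
  apply: measurable_fun_ifT; first exact: measurable_fun_ltr.
    apply: measurable_funM; last exact: measurable_fun_G.
    exact: (measurableT_comp measurable_invr my2).
  apply: measurable_funM => //.
  by apply: measurable_fun_Gamma => //; exact: measurable_fun_sqdist.
have k0 y : (0 <= k y)%R.
  rewrite /k /K; case: ifPn => // y0; case: ifPn => _.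
    by rewrite mulr_ge0 ?invr_ge0// G_ge0// ltW.
  by rewrite mulr_ge0 ?Gamma_ge0// divr_ge0// ltW.
have mb : measurable_fun setT (fun e : boundary => (e, 0%R) : space).
  exact: measurable_fun_pair.
transitivity (\int[mu]_y (k y)%:E).
  rewrite integral_mkcond; apply: eq_integral => y _; rewrite patchE /k.
  have -> : (y \in @cOmega R n.+1) = (0 <= y.2)%R by apply/idP/idP; rewrite inE.
  by case: ifPn.
rewrite (@integral_datum _ _ _ _ _ _ _ mu (leb n.+1) (leb_bdry n.+1) id
  (fun e => (e, 0%R)) w h1)//; last first.
  move=> E mE; rewrite hmu//; congr (_ + _).
  - rewrite [LHS](@eq_integral_ae_measurable _ _ _ _ _ _
      (fun y : space => ((y.2 : R) * f1 y)%:E)).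
    + rewrite integral_mkcond. apply: eq_integral => y _; rewrite patchE in_setI OE.
      rewrite indicE /w; case: (y \in E); rewrite ?mul1r ?mul0r//=.
      by case: ifPn.
    + by apply: measurableI => //; exact: measurable_Omega.
    + by move=> y [_ Oy]; rewrite lee_fin mulr_ge0 ?f_ge0// ltW.
    + by move=> y [_ Oy]; rewrite lee_fin mulr_ge0// ltW.
    + by apply/measurable_EFinP; apply: measurable_funTS; exact: measurable_funM.
    + by apply: filterS ff1 => y fy [_ Oy]; rewrite fy.
  - rewrite [LHS](@eq_integral_ae_measurable _ _ _ _ _ _ (fun e => (h1 e)%:E)).
    + rewrite integral_mkcond; apply: eq_integral => e _; rewrite patchE.
      have -> : (e \in [set e' | E (e', 0%R)]) = ((e, 0%R) \in E).
        by apply/idP/idP; rewrite !inE.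
      by rewrite indicE; case: (_ \in E); rewrite ?mul1r ?mul0r.
    + rewrite (_ : mkset _ = (fun e : boundary => (e, 0%R)) @^-1` E)//.
      by rewrite -[X in measurable X]setTI; exact: mb.
    + by move=> e _; rewrite lee_fin.
    + by move=> e _; rewrite lee_fin.
    + by apply/measurable_EFinP; exact: measurable_funTS.
    + by apply: filterS hh1 => e he _; rewrite he.
congr (_ + _); apply: eq_integral => y _; congr (_%:E).
  rewrite /k /w /K /interior_kernel /= Ox t0 andbT.
  case: (ltP 0%R (y.2 : R)) => y0; last by rewrite mulr0 mul0r.
  by rewrite (ltW y0) mulrACA mulVf ?gt_eqF// mul1r.
by rewrite /k /K /= lexx ltxx /boundary_kernel Ox t0.
Qed.

End borel_representatives.

(** * Bounds for the Duhamel term *)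
Section essential_bounds.
Context d (X : measurableType d) (R : realType).
Variable m : {measure set X -> \bar R}.
Local Open Scope ereal_scope.

Lemma le_Lnorm_oo (g : X -> \bar R) : {ae m, forall x, g x <= 'N[m]_+oo[g]}.
Proof.
rewrite unlock /Lnorm; case: ifPn => [_|].
  by apply: filterS (ess_sup_ge m (abse \o g)) => x; apply: le_trans; exact: lee_abs.
rewrite -leNgt => m0; exists setT; split => //.
by apply/eqP; rewrite eq_le m0 measure_ge0.
Qed.

(** As the function a is not assumed measurable, the constant is moved to the side
    of f before integrating. *)
Lemma le_integral_mul_const (D : set X) (f a : X -> \bar R) (r : R) :
  measurable D -> measurable_fun D f -> (forall x, D x -> 0 <= f x) ->
  (forall x, D x -> 0 <= a x) -> (0 <= r)%R ->
  (forall x, D x -> f x <= r%:E * a x) ->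
  \int[m]_(x in D) f x <= r%:E * \int[m]_(x in D) a x.
Proof.
move=> mD mf f0 a0; rewrite le_eqVlt => /predU1P[<-|r0] fa.
  rewrite mul0e (@le_trans _ _ (\int[m]_(x in D) 0))//.
    by apply: le_integral_ge0 => // x Dx; rewrite (le_trans (fa x Dx))// mul0e.
  by rewrite integral0.
rewrite -lee_pdivrMl// -ge0_integralZl_EFin//; last by rewrite invr_ge0 ltW.
apply: le_integral_ge0 => x Dx.
  by rewrite mule_ge0 ?f0// lee_fin invr_ge0 ltW.
by rewrite lee_pdivrMl//; exact: fa.
Qed.

End essential_bounds.

Section duhamel.
Context {R : realType} (n : nat).
Local Notation space := (ambient R n.+1).
Local Notation spacetime := (space * measurableTypeR R)%type.
Local Open Scope ereal_scope.

(** The Duhamel term as one integral operator on space-time, so that a single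
    application of Tonelli's theorem gives its measurability and monotone
    iteration applies to it. *)
Definition duhamel_kernel (zw : spacetime * spacetime) : R :=
  if (0 < zw.2.2)%R then interior_kernel zw.1.1 zw.2.1 (zw.1.2 - zw.2.2)%R else 0%R.

Lemma duhamel_kernel_ge0 zw : (0 <= duhamel_kernel zw)%R.
Proof. by rewrite /duhamel_kernel; case: ifPn => // _; exact: interior_kernel_ge0. Qed.

Let measurable_time1 :
  measurable_fun setT (fun zw : spacetime * spacetime => zw.1.2 : R).
Proof. exact: (measurableT_comp measurable_snd measurable_fst). Qed.

Let measurable_time2 :
  measurable_fun setT (fun zw : spacetime * spacetime => zw.2.2 : R).
Proof. exact: (measurableT_comp measurable_snd measurable_snd). Qed.

Lemma measurable_duhamel_kernel : measurable_fun setT duhamel_kernel.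
Proof.
apply: measurable_fun_ifT => //; first exact: measurable_fun_ltr.
apply: measurable_fun_interior_kernel.
- exact: (measurableT_comp measurable_fst measurable_fst).
- exact: (measurableT_comp measurable_fst measurable_snd).
- exact: measurable_funB.
Qed.

Lemma duhamel_iterated (F : spacetime -> \bar R) (x : space) (t : R) :
  measurable_fun setT F -> (forall w, 0 <= F w) ->
  \int[leb_time n.+1]_w ((duhamel_kernel ((x, t), w))%:E * F w) =
  \int[lebesgue_measure]_(s in `]0%R, t[)
    \int[leb n.+1]_y ((interior_kernel x y (t - s))%:E * F (y, s)).
Proof.
move=> mF F0.
rewrite [LHS](fubini_tonelli2 (m1 := leb n.+1) (m2 := lebesgue_measure)
  (fun w => (duhamel_kernel ((x, t), w))%:E * F w)); last 2 first.
- apply: emeasurable_funM => //; apply/measurable_EFinP.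
  by have /(measurable_fun_pair2 (x, t)) := measurable_duhamel_kernel.
- by move=> w; rewrite mule_ge0// lee_fin duhamel_kernel_ge0.
rewrite [RHS]integral_mkcond; apply: eq_integral => s _.
rewrite /fubini_G patchE mem_setE in_itv/= /duhamel_kernel /=.
case: (ltP 0%R s) => s0 /=; last by rewrite integral0_eq// => y _; rewrite mul0e.
case: ifPn => // ts; rewrite integral0_eq// => y _.
by rewrite /interior_kernel subr_gt0 (negbTE ts) !andbF mul0e.
Qed.

Lemma measurable_duhamel_slice (F : spacetime -> \bar R) (x : space) (t : R) :
  measurable_fun setT F -> (forall w, 0 <= F w) ->
  measurable_fun setT
    (fun s : measurableTypeR R =>
      \int[leb n.+1]_y ((interior_kernel x y (t - s))%:E * F (y, s))).
Proof.
move=> mF F0.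
apply: (measurable_fun_fubini_tonelli_G (m1 := leb n.+1)
  (fun w : spacetime => (interior_kernel x w.1 (t - w.2))%:E * F w)).
  apply: emeasurable_funM => //; apply/measurable_EFinP.
  by apply: measurable_fun_interior_kernel => //; exact: measurable_funB.
by move=> w; rewrite mule_ge0// lee_fin interior_kernel_ge0.
Qed.

(** For fixed s, psi^p is bounded by C a(s) q(s), and the sub-semigroup property
    carries q(s) to q(t) whatever s is; only the integral of a(s) remains. *)
Lemma duhamel_bound (p C b t : R) (x : space) (psi q : spacetime -> R)
    (a : R -> \bar R) :
  measurable_fun setT psi -> (forall w, 0 <= psi w)%R ->
  measurable_fun setT q -> (forall w, 0 <= q w)%R -> (0 <= C)%R ->
  (forall s, 0 <= a s) ->
  (forall s, (0 < s < t)%R -> {ae leb n.+1, forall y, Omega y ->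
     (psi (y, s) `^ p)%:E <= C%:E * a s * (q (y, s))%:E}) ->
  (forall s, (0 < s < t)%R ->
     \int[leb n.+1]_y (interior_kernel x y (t - s) * q (y, s))%:E <= (q (x, t))%:E) ->
  C%:E * (q (x, t))%:E * \int[lebesgue_measure]_(s in `]0%R, t[) a s <= b%:E ->
  \int[leb_time n.+1]_w
    ((duhamel_kernel ((x, t), w))%:E * (psi w `^ p)%:E) <= b%:E.
Proof.
move=> mpsi psi0 mq q0 C0 a0 psiq qsub; apply: le_trans.
have mF : measurable_fun setT (fun w => (psi w `^ p)%:E).
  by apply/measurable_EFinP; exact: (measurableT_comp (measurable_powR p) mpsi).
have F0 w : 0 <= (psi w `^ p)%:E by rewrite lee_fin powR_ge0.
rewrite duhamel_iterated// -EFinM.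
apply: le_integral_mul_const => //.
- exact: (measurable_funTS (measurable_duhamel_slice x t mF F0)).
- move=> s _; apply: integral_ge0 => y _.
  by rewrite mule_ge0// lee_fin interior_kernel_ge0.
- by rewrite mulr_ge0.
move=> s; rewrite /= in_itv/= => s0t.
have [|] := boolP (0 < s < t)%R; last by rewrite s0t.
move=> _; have mGq : measurable_fun setT
    (fun y => (interior_kernel x y (t - s) * q (y, s))%:E).
  apply/measurable_EFinP; apply: measurable_funM; first exact: measurable_fun_interior_kernel.
  by have /(measurable_fun_pair1 (s : measurableTypeR R)) := mq.
apply: (@le_trans _ _ (C%:E * a s *
    \int[leb n.+1]_y (interior_kernel x y (t - s) * q (y, s))%:E)).
  rewrite -ge0_integralZl//; last 2 first.
  - by move=> y _; rewrite lee_fin mulr_ge0 ?interior_kernel_ge0.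
  - by rewrite mule_ge0.
  apply: ae_ge0_le_integral => //.
  - by move=> y _; rewrite mule_ge0// lee_fin interior_kernel_ge0.
  - apply: emeasurable_funM.
      by apply/measurable_EFinP; exact: measurable_fun_interior_kernel.
    by have /(measurable_fun_pair1 (s : measurableTypeR R)) := mF.
  - by move=> y _; rewrite !mule_ge0// lee_fin mulr_ge0 ?interior_kernel_ge0.
  - exact: measurable_funeM.
  - apply: filterS (psiq s s0t) => y psiqy _.
    have [y0|y0] := ltP 0%R (y.2 : R); last first.
      by rewrite /interior_kernel [(0 < y.2)%R]ltNge y0 andbF mul0e mul0r mule0.
    rewrite [in leRHS]EFinM muleCA lee_wpmul2l ?lee_fin ?interior_kernel_ge0//.
    exact: psiqy.
rewrite [in leRHS]EFinM [leRHS]muleAC lee_wpmul2l//; last exact: qsub.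
by rewrite mule_ge0.
Qed.

End duhamel.

(** * The power of the supersolution *)
Section power_of_the_supersolution.
Context {R : realType} (n : nat).
Local Notation space := (ambient R n.+1).
Local Notation spacetime := (space * measurableTypeR R)%type.

Lemma powR_addr_le (p a b : R) : 1 <= p -> 0 <= a -> 0 <= b ->
  (a + b) `^ p <= 2 `^ (p - 1) * (a `^ p + b `^ p).
Proof.
move=> p1 a0 b0.
have h01 : 0 <= (2^-1 : R) <= 1 by rewrite invr_ge0 ler0n/= invf_le1// ler1n.
have := convex_gauge_le (convex_powR p1) (mulr_ge0 (ler0n R 2) a0)
  (mulr_ge0 (ler0n R 2) b0) h01.
rewrite (_ : _ * _ + _ = a + b); last by field.
move=> /le_trans; apply; rewrite !powRM//.
rewrite (_ : 1 - 2^-1 = 2^-1 :> R); last by field.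
rewrite -!mulrDr mulrA ler_wpM2r ?addr_ge0 ?powR_ge0//.
rewrite powRB; last by rewrite pnatr_eq0 implybT.
by rewrite powRr1// mulrC.
Qed.

Variable Phi : R -> R.
Hypothesis Phi_incr : {in `[0, +oo[ &, {homo Phi : x y / x < y}}.
Hypothesis Phi_convex : convex_function (`[0, +oo[%classic : set R) Phi.
Hypothesis Phi0 : Phi 0 = 0.

Let Phi_inv_ge0' := Phi_inv_ge0 Phi_incr Phi_convex Phi0.

Lemma fA_mul p tau : 0 < p -> 0 <= tau -> fA Phi p tau * tau = Phi_inv Phi tau `^ p.
Proof.
move=> p0; rewrite le_eqVlt => /predU1P[<-|tau0].
  by rewrite mulr0 Phi_inv0// powR0// gt_eqF.
by rewrite /fA divfK// gt_eqF.
Qed.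

Lemma fB_mul tau : 0 <= tau -> fB Phi tau * Phi_inv Phi tau = tau.
Proof.
rewrite le_eqVlt => /predU1P[<-|tau0].
  by rewrite Phi_inv0// mulr0.
by rewrite /fB divfK// gt_eqF// Phi_inv_gt0.
Qed.

(** Both halves of the supersolution have this form: v with kappa = 1 and q0 the
    potential of Phi(f), w with kappa the normal factor and q0 the heat potential
    of Phi(h). The maximum with 0 makes it a Borel function of q0. *)
Definition lifted_profile (kappa q0 : spacetime -> R) (z : spacetime) : R :=
  2 * kappa z * Phi_inv Phi (Num.max (q0 z) 0).

(** In the hypotheses below, a and bn stand for the essential suprema of A(q0) and
    B(q0) at a given time, and c omega(s) bounds kappa^(p-1). *)
Variables (p : R) (T : \bar R).
Hypothesis p_gt1 : 1 < p.
Variables (kappa q0 : spacetime -> R) (omega : R -> R) (c : R).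
Variables (a bn : R -> \bar R).
Hypotheses (mkappa : measurable_fun setT kappa) (kappa_ge0 : forall z, 0 <= kappa z).
Hypotheses (mq0 : measurable_fun setT q0) (q0_ge0 : forall z, 0 <= q0 z).
Hypotheses (omega_ge0 : forall s, 0 <= omega s) (c_gt0 : 0 < c).
Hypothesis a_ge0 : forall s, (0 <= a s)%E.
Hypothesis A_le : forall s, 0 < s -> (s%:E < T)%E ->
  {ae leb n.+1, forall y, Omega y -> ((fA Phi p (q0 (y, s)))%:E <= a s)%E}.
Hypothesis B_le : forall t, 0 < t -> (t%:E < T)%E ->
  {ae leb n.+1, forall x, Omega x -> ((fB Phi (q0 (x, t)))%:E <= bn t)%E}.
Hypothesis kappa_le : forall y s, Omega y -> 0 < s ->
  kappa (y, s) `^ (p - 1) <= c * omega s.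
Hypothesis small : forall t, 0 < t -> (t%:E < T)%E ->
  (bn t * \int[lebesgue_measure]_(s in `]0%R, t[) ((omega s)%:E * a s) <=
   (2 `^ (- (2 * p) + 1) / c)%:E)%E.
Hypothesis sub : forall x s t, 0 < s -> s < t -> (t%:E < T)%E -> Omega x ->
  (\int[leb n.+1]_y (interior_kernel x y (t - s) * (kappa (y, s) * q0 (y, s)))%:E <=
   (kappa (x, t) * q0 (x, t))%:E)%E.

Local Notation psi := (lifted_profile kappa q0).

Lemma lifted_profile_ge0 z : 0 <= psi z.
Proof.
rewrite /lifted_profile mulr_ge0 ?mulr_ge0// Phi_inv_ge0'//.
by rewrite le_max lexx orbT.
Qed.

Lemma measurable_lifted_profile : measurable_fun setT psi.
Proof.
apply: measurable_funM; first exact: measurable_funM.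
exact: (measurableT_comp (measurable_Phi_inv Phi_incr Phi_convex Phi0) mq0).
Qed.

(** With q = kappa q0 one has psi^p = 2^p kappa^(p-1) A(q0) q <= 2^p c omega a q, so
    the Duhamel term of psi^p is at most 2^p c q int_0^t omega a. Writing
    q = B(q0) psi / 2 and using the smallness condition bounds this by
    2^p 2^(-2p+1) psi / 2 = 2^(-p) psi. *)
Lemma duhamel_power_le t : 0 < t -> (t%:E < T)%E ->
  {ae leb n.+1, forall x, Omega x ->
    (\int[leb_time n.+1]_w ((duhamel_kernel ((x, t), w))%:E * (psi w `^ p)%:E) <=
     (2 `^ (- p) * psi (x, t))%:E)%E}.
Proof.
move=> t0 tT; apply: filterS (B_le t0 tT) => x Bx Ox.
have p0 : 0 < p by apply: lt_trans p_gt1.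
pose q z := kappa z * q0 z.
have two0 r : 0 < 2 `^ r :> R by rewrite powR_gt0.
apply: (@duhamel_bound _ _ p (2 `^ p * c) _ t x psi q
  (fun s => (omega s)%:E * a s)%E).
- exact: measurable_lifted_profile.
- exact: lifted_profile_ge0.
- exact: measurable_funM.
- by move=> z; rewrite mulr_ge0.
- by rewrite mulr_ge0// ltW.
- by move=> s; rewrite mule_ge0// lee_fin.
- move=> s /andP[s0 st].
  have sT : (s%:E < T)%E by apply: lt_trans tT; rewrite lte_fin.
  apply: filterS (A_le s0 sT) => y Ay Oy.
  have -> : psi (y, s) `^ p =
      2 `^ p * kappa (y, s) `^ (p - 1) * kappa (y, s) *
      (fA Phi p (q0 (y, s)) * q0 (y, s)).
    rewrite fA_mul// /lifted_profile max_l//.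
    rewrite !powRM ?mulr_ge0 ?Phi_inv_ge0'//; congr (_ * _); rewrite -mulrA; congr (_ * _).
    rewrite -{3}(powRr1 (kappa_ge0 (y, s))) -powRD ?subrK//.
    by rewrite gt_eqF.
  have -> : 2 `^ p * kappa (y, s) `^ (p - 1) * kappa (y, s) *
      (fA Phi p (q0 (y, s)) * q0 (y, s)) =
    (2 `^ p * kappa (y, s) `^ (p - 1)) * fA Phi p (q0 (y, s)) * q (y, s).
    by rewrite /q; ring.
  rewrite EFinM lee_wpmul2r ?lee_fin ?mulr_ge0//.
  rewrite EFinM [in leRHS]EFinM -muleA muleA.
  apply: (@le_trans _ _ ((2 `^ p * kappa (y, s) `^ (p - 1))%:E * a s)%E).
    by rewrite lee_wpmul2l ?Ay// lee_fin mulr_ge0 ?powR_ge0// ltW.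
  by rewrite muleA -!EFinM lee_wpmul2r// lee_fin -mulrA ler_wpM2l ?kappa_le.
- by move=> s /andP[s0 st]; exact: sub.
have qE : q (x, t) = fB Phi (q0 (x, t)) * (psi (x, t) / 2).
  rewrite /lifted_profile max_l//.
  rewrite (_ : _ / 2 = kappa (x, t) * Phi_inv Phi (q0 (x, t))); last by field.
  by rewrite mulrCA fB_mul.
have I0 : (0 <= \int[lebesgue_measure]_(s in `]0%R, t[) ((omega s)%:E * a s))%E.
  by apply: integral_ge0 => s _; rewrite mule_ge0// lee_fin.
have -> I : ((2 `^ p * c)%:E * (q (x, t))%:E * I =
    (2 `^ p * c * (psi (x, t) / 2))%:E * ((fB Phi (q0 (x, t)))%:E * I))%E.
  by rewrite qE muleA -!EFinM; congr (_%:E * _)%E; ring.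
have psi2 : 0 <= psi (x, t) / 2 by rewrite divr_ge0// lifted_profile_ge0.
have C0 : 0 <= 2 `^ p * c * (psi (x, t) / 2).
  by rewrite mulr_ge0// mulr_ge0// ltW.
apply: (@le_trans _ _ ((2 `^ p * c * (psi (x, t) / 2))%:E *
    (2 `^ (- (2 * p) + 1) / c)%:E)%E).
  rewrite lee_wpmul2l ?lee_fin//; apply: le_trans (small t0 tT).
  by rewrite lee_wpmul2r//; exact: Bx.
rewrite -EFinM lee_fin.
have -> : 2 `^ (- (2 * p) + 1) = 2 `^ (- p) * 2 `^ (- p) * 2 :> R.
  have -> : - (2 * p) + 1 = - p - p + 1 by ring.
  by rewrite 2?powRD ?pnatr_eq0 ?implybT// powRr1.
have -> : 2 `^ p * c * (psi (x, t) / 2) * (2 `^ (- p) * 2 `^ (- p) * 2 / c) =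
    (2 `^ p * 2 `^ (- p)) * (2 `^ (- p) * psi (x, t)).
  by field; rewrite gt_eqF.
rewrite -powRD ?pnatr_eq0 ?implybT// subrr powRr0 mul1r.
exact: lexx.
Qed.

End power_of_the_supersolution.

(** * Construction of the solution *)
Section existence.
Context {R : realType} (n : nat).
Local Notation space := (ambient R n.+1).
Local Notation boundary := (bdry R n.+1).
Local Notation spacetime := (space * measurableTypeR R)%type.

Variables (p : R) (f f1 : space -> R) (h h1 : boundary -> R) (T : \bar R).
Variable Phi : R -> R.
Hypothesis p_gt1 : 1 < p.
Hypotheses (f_ge0 : forall y, Omega y -> 0 <= f y).
Hypotheses (mf1 : measurable_fun setT f1) (f1_ge0 : forall y, 0 <= f1 y).
Hypothesis ff1 : {ae leb n.+1, forall y, Omega y -> f y = f1 y}.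
Hypotheses (h_ge0 : forall e, 0 <= h e).
Hypotheses (mh1 : measurable_fun setT h1) (h1_ge0 : forall e, 0 <= h1 e).
Hypothesis hh1 : {ae leb_bdry n.+1, forall e, h e = h1 e}.
Hypothesis Phi_incr : {in `[0, +oo[ &, {homo Phi : x y / x < y}}.
Hypothesis Phi_ge0 : forall x, 0 <= x -> 0 <= Phi x.
Hypothesis Phi_convex : convex_function (`[0, +oo[%classic : set R) Phi.
Hypothesis Phi0 : Phi 0 = 0.
Hypothesis Gfin : forall t x, 0 < t -> (t%:E < T)%E -> Omega x ->
  (Gop t (Phi \o f) x < +oo)%E.
Hypothesis Gammafin : forall t x', 0 < t -> (t%:E < T)%E ->
  (Gammaop t (Phi \o h) x' < +oo)%E.
Hypothesis small_f_or0 :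
  {ae leb n.+1, forall x, Omega x -> f x = 0} \/ small_f Phi f p T.
Hypothesis small_h_or0 :
  {ae leb_bdry n.+1, forall x', h x' = 0} \/ small_h Phi h p T.

Let measurable_Phi_comp d (X : measurableType d) (g : X -> R) :
  measurable_fun setT g -> (forall x, 0 <= g x) -> measurable_fun setT (Phi \o g).
Proof.
move=> mg g0.
have -> : Phi \o g = (fun x => Phi (Num.max x 0)) \o g.
  by apply/funext => x /=; rewrite max_l.
exact: (measurableT_comp (measurable_gauge Phi_incr) mg).
Qed.

Let mPhif := measurable_Phi_comp mf1 f1_ge0.
Let mPhih := measurable_Phi_comp mh1 h1_ge0.
Let Phif_ge0 y : 0 <= (Phi \o f1) y. Proof. exact: Phi_ge0. Qed.
Let Phih_ge0 y : 0 <= (Phi \o h1) y. Proof. exact: Phi_ge0. Qed.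

Let qf (z : spacetime) : R := fine (interior_potential (Phi \o f1) z).
Let qh (z : spacetime) : R := fine (heat_potential (Phi \o h1) (z.1.1, z.2)).

(** The normal factor, extended by 0 so as to be nonnegative everywhere. *)
Let normal_weight (z : spacetime) : R :=
  if (0 < z.1.2) && (0 < z.2) then normal_factor z.1.2 z.2 else 0.

Let v := lifted_profile Phi (cst 1) qf.
Let w := lifted_profile Phi normal_weight qh.

Let qf_ge0 z : 0 <= qf z.
Proof. by apply: fine_ge0; exact: interior_potential_ge0. Qed.

Let qh_ge0 z : 0 <= qh z.
Proof. by apply: fine_ge0; exact: heat_potential_ge0. Qed.

Let mqf : measurable_fun setT qf.
Proof.
apply: measurableT_comp; last exact: measurable_interior_potential.
exact: fine_measurable.
Qed.

Let mqh : measurable_fun setT qh.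
Proof.
apply: measurableT_comp; first exact: fine_measurable.
apply: (measurableT_comp (measurable_heat_potential mPhih Phih_ge0)).
apply: measurable_fun_pair; last exact: measurable_snd.
exact: (measurableT_comp measurable_fst measurable_fst).
Qed.

Let qfE x t : Omega x -> 0 < t -> (t%:E < T)%E ->
  (qf (x, t))%:E = interior_potential (Phi \o f1) (x, t).
Proof.
move=> Ox t0 tT; rewrite fineK// ge0_fin_numE; last exact: interior_potential_ge0.
rewrite -(Gop_interior_potential f_ge0 f1_ge0 ff1)//; exact: Gfin.
Qed.

Let qhE x t : 0 < t -> (t%:E < T)%E ->
  (qh (x, t))%:E = heat_potential (Phi \o h1) (x.1, t).
Proof.
move=> t0 tT; rewrite fineK// ge0_fin_numE; last exact: heat_potential_ge0.
rewrite -(Gammaop_heat_potential h_ge0 h1_ge0 hh1)//; exact: Gammafin.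
Qed.

Let qf_GPhi x t : Omega x -> 0 < t -> qf (x, t) = GPhi Phi f t x.
Proof.
by move=> Ox t0; rewrite /GPhi (Gop_interior_potential f_ge0 f1_ge0 ff1).
Qed.

Let qh_GammaPhi x t : qh (x, t) = GammaPhi Phi h t x.1.
Proof. by rewrite /GammaPhi (Gammaop_heat_potential h_ge0 h1_ge0 hh1). Qed.

Let normal_weight_ge0 z : 0 <= normal_weight z.
Proof.
rewrite /normal_weight; case: ifPn => // /andP[x0 t0].
by rewrite normal_factor_ge0// ltW.
Qed.

Let mnormal_weight : measurable_fun setT normal_weight.
Proof.
have mx : measurable_fun setT (fun z : spacetime => z.1.2 : R).
  exact: (measurableT_comp measurable_snd measurable_fst).
have mt : measurable_fun setT (fun z : spacetime => z.2 : R) by exact: measurable_snd.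
apply: measurable_fun_ifT => //.
  by apply: measurable_and; exact: measurable_fun_ltr.
apply: measurable_funM; first exact: measurable_fun_div.
by apply: measurable_fun_Gamma => //; exact: measurable_funX.
Qed.

Let v_ge0 z : 0 <= v z.
Proof. exact: lifted_profile_ge0. Qed.

Let w_ge0 z : 0 <= w z.
Proof. exact: lifted_profile_ge0. Qed.

Let mv : measurable_fun setT v.
Proof. exact: measurable_lifted_profile. Qed.

Let mw : measurable_fun setT w.
Proof. exact: measurable_lifted_profile. Qed.

Let fvE x t : Omega x -> 0 < t -> fv Phi f x t = v (x, t).
Proof.
by move=> Ox t0; rewrite /fv /v /lifted_profile -qf_GPhi// mulr1 max_l.
Qed.

Let fwE x t : Omega x -> 0 < t -> fw Phi h x t = w (x, t).
Proof.
move=> Ox t0; rewrite /fw /w /lifted_profile -qh_GammaPhi max_l//.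
by rewrite /normal_weight /= Ox t0 /= /normal_factor; ring.
Qed.

Let lifted_profile_eq0 kappa (q : spacetime -> R) z : q z = 0 ->
  lifted_profile Phi kappa q z = 0.
Proof. by move=> q0; rewrite /lifted_profile q0 maxxx Phi_inv0// mulr0. Qed.

Let zero_power_le psi t : (forall z, psi z = 0) ->
  {ae leb n.+1, forall x, Omega x ->
    (\int[leb_time n.+1]_z ((duhamel_kernel ((x, t), z))%:E * (psi z `^ p)%:E) <=
     (2 `^ (- p) * psi (x, t))%:E)%E}.
Proof.
move=> psi0; apply: aeW => x _.
rewrite integral0_eq ?psi0 ?mulr0// => z _.
by rewrite psi0 powR0 ?mule0// gt_eqF// (lt_trans ltr01).
Qed.

Let duhamel_v_le t : 0 < t -> (t%:E < T)%E ->
  {ae leb n.+1, forall x, Omega x ->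
    (\int[leb_time n.+1]_z ((duhamel_kernel ((x, t), z))%:E * (v z `^ p)%:E) <=
     (2 `^ (- p) * v (x, t))%:E)%E}.
Proof.
case: small_f_or0 => [f_eq0|small] t0 tT.
  apply: zero_power_le => z; apply: lifted_profile_eq0.
  rewrite /qf /interior_potential.
  rewrite (@eq_integral_ae_measurable _ _ _ (leb n.+1) _ _ (cst 0)%E)//.
  - by rewrite integral0.
  - by move=> y _; rewrite lee_fin mulr_ge0 ?interior_kernel_ge0.
  - apply: filterS2 ff1 f_eq0 => y fy f0 _ /=.
    rewrite /interior_kernel; case: ifPn => [/and3P[_ y0 _]|_]; last by rewrite mul0r.
    by rewrite -fy// f0// Phi0 mulr0.
apply: (@duhamel_power_le _ _ _ Phi_incr Phi_convex Phi0 p T p_gt1 (cst 1) qf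
  (cst 1) 1 (fun s => norm_Omega (fun x => fA Phi p (GPhi Phi f s x)))
  (fun s => norm_Omega (fun x => fB Phi (GPhi Phi f s x)))) => //.
- by move=> s; exact: Lnorm_ge0.
- move=> s s0 sT.
  apply: filterS (le_Lnorm_oo (leb n.+1)
    ((EFin \o (fun x => fA Phi p (GPhi Phi f s x))) \_ (@Omega R n.+1))) => y.
  by move=> /[swap] Oy; rewrite patchE mem_set// qf_GPhi.
- move=> s s0 sT.
  apply: filterS (le_Lnorm_oo (leb n.+1)
    ((EFin \o (fun x => fB Phi (GPhi Phi f s x))) \_ (@Omega R n.+1))) => y.
  by move=> /[swap] Oy; rewrite patchE mem_set// qf_GPhi.
- by move=> y s _ _; rewrite powR1 mulr1.
- move=> s s0 sT; rewrite divr1; under eq_integral do rewrite mul1e.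
  apply: le_trans small; apply: ereal_sup_ubound; exists s => //; exact: conj.
- move=> x s r s0 sr rT Ox.
  have sT : (s%:E < T)%E by apply: lt_trans rT; rewrite lte_fin.
  rewrite [X in (_ <= X%:E)%E]mul1r (qfE Ox (lt_trans s0 sr) rT).
  apply: le_trans (interior_potential_semigroup mPhif Phif_ge0 x s0 sr).
  apply: le_integral_ge0 => y _; first by rewrite lee_fin !mulr_ge0 ?interior_kernel_ge0.
  rewrite mul1r; have [y0|y0] := ltP 0 (y.2 : R); first by rewrite EFinM qfE.
  by rewrite /interior_kernel [0 < y.2]ltNge y0 /= andbF mul0r mul0e.
Qed.

Let duhamel_w_le t : 0 < t -> (t%:E < T)%E ->
  {ae leb n.+1, forall x, Omega x ->
    (\int[leb_time n.+1]_z ((duhamel_kernel ((x, t), z))%:E * (w z `^ p)%:E) <=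
     (2 `^ (- p) * w (x, t))%:E)%E}.
Proof.
case: small_h_or0 => [h_eq0|small] t0 tT.
  apply: zero_power_le => z; apply: lifted_profile_eq0.
  rewrite /qh /heat_potential.
  rewrite (@eq_integral_ae_measurable _ _ _ (leb_bdry n.+1) _ _ (cst 0)%E)//.
  - by rewrite integral0.
  - by move=> y _; rewrite lee_fin mulr_ge0 ?Gamma_ge0.
  - apply: filterS2 hh1 h_eq0 => y hy h0 _ /=.
    by rewrite -hy h0 Phi0 mulr0.
have e0 : 0 < 2 * expR 1 * pi :> R by rewrite !mulr_gt0 ?expR_gt0 ?pi_gt0.
apply: (@duhamel_power_le _ _ _ Phi_incr Phi_convex Phi0 p T p_gt1 normal_weight qh
  (fun s => s `^ (- (p - 1))) ((2 * expR 1 * pi) `^ (- ((p - 1) / 2)))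
  (fun s => norm_bdry (fun x => fA Phi p (GammaPhi Phi h s x)))
  (fun s => norm_bdry (fun x => fB Phi (GammaPhi Phi h s x)))) => //.
- by move=> s; exact: powR_ge0.
- by rewrite powR_gt0.
- by move=> s; exact: Lnorm_ge0.
- move=> s s0 sT.
  have := ae_sfprod_fst lebesgue_measure (le_Lnorm_oo (leb_bdry n.+1)
    (EFin \o (fun x => fA Phi p (GammaPhi Phi h s x)))).
  by apply: filterS => y ? Oy; rewrite qh_GammaPhi.
- move=> s s0 sT.
  have := ae_sfprod_fst lebesgue_measure (le_Lnorm_oo (leb_bdry n.+1)
    (EFin \o (fun x => fB Phi (GammaPhi Phi h s x)))).
  by apply: filterS => y ? Oy; rewrite qh_GammaPhi.
- move=> y s Oy s0; rewrite /normal_weight /= Oy s0 /=.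
  have p10 : 0 <= p - 1 by rewrite subr_ge0 ltW.
  apply: (@le_trans _ _ (((2 * expR 1 * pi) `^ (- (1 / 2)) / s) `^ (p - 1))).
    apply: ge0_ler_powR => //.
    + by rewrite nnegrE normal_factor_ge0// ltW.
    + by rewrite nnegrE divr_ge0 ?powR_ge0// ltW.
    + by apply: normal_factor_le => //; exact: ltW.
  rewrite powRM ?powR_ge0 ?invr_ge0 ?(ltW s0)// -[s^-1]powR_inv1 ?(ltW s0)//.
  rewrite -!powRrM le_eqVlt; apply/orP; left; apply/eqP.
  by congr (_ `^ _ * _ `^ _); field.
- move=> s s0 sT; rewrite powRN invrK.
  by apply: le_trans small; apply: ereal_sup_ubound; exists s => //; exact: conj.
- move=> x s r s0 sr rT Ox.
  have sT : (s%:E < T)%E by apply: lt_trans rT; rewrite lte_fin.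
  have r0 := lt_trans s0 sr.
  have potE y a : 0 < (y.2 : R) -> 0 < a -> (a%:E < T)%E ->
      (normal_weight (y, a) * qh (y, a))%:E = boundary_potential (Phi \o h1) (y, a).
    move=> y0 a0 aT; rewrite EFinM qhE// boundary_potentialE//.
    by rewrite /normal_weight /= y0 a0.
  rewrite potE//.
  apply: le_trans (boundary_potential_semigroup mPhih Phih_ge0 x s0 sr).
  apply: le_integral_ge0 => y _; first by rewrite lee_fin !mulr_ge0 ?interior_kernel_ge0.
  have [y0|y0] := ltP 0 (y.2 : R); first by rewrite EFinM potE.
  by rewrite /interior_kernel [0 < y.2]ltNge y0 /= andbF mul0r mul0e.
Qed.

(** Jensen's inequality, for G(t) of mass at most 1 and for the Gaussian of mass 1:
    the linear part takes one half of v + w. *)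
Let linear_part_le x t : Omega x -> 0 < t -> (t%:E < T)%E ->
  (interior_potential f1 (x, t) + boundary_potential h1 (x, t) <=
   ((v (x, t) + w (x, t)) / 2)%:E)%E.
Proof.
move=> Ox t0 tT.
have -> : (v (x, t) + w (x, t)) / 2 = Phi_inv Phi (qf (x, t)) +
    normal_factor x.2 t * Phi_inv Phi (qh (x, t)).
  rewrite /v /w /lifted_profile !max_l// /normal_weight /= Ox t0 /=.
  by field.
rewrite EFinD; apply: leeD.
  apply: (jensen_subprobability Phi_incr Phi_ge0 Phi_convex Phi0) => //.
  - exact: measurable_fun_interior_kernel.
  - by move=> y; exact: interior_kernel_ge0.
  - exact: integral_interior_kernel_le1.
  - by rewrite qfE.
rewrite boundary_potentialE// [leRHS]EFinM lee_wpmul2l//.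
  by rewrite lee_fin normal_factor_ge0// ltW.
apply: (jensen_subprobability Phi_incr Phi_ge0 Phi_convex Phi0) => //.
- by apply: measurable_fun_Gamma => //; exact: measurable_fun_sqdist'.
- by move=> y; exact: Gamma_ge0.
- by rewrite integral_Gamma_sqdist'.
- by rewrite qhE.
Qed.

Let U (z : spacetime) := (interior_potential f1 z + boundary_potential h1 z)%E.

Let inQT (z : spacetime) := [&& 0 < z.1.2, 0 < z.2 & (z.2%:E < T)%E].

(** The value +oo outside Q_T makes the supersolution inequality trivial there,
    whereas the Duhamel term at a point of Q_T only sees V inside Q_T. *)
Let V (z : spacetime) : \bar R := if inQT z then (v z + w z)%:E else +oo%E.

Let mV : measurable_fun setT V.
Proof.
apply: measurable_fun_ifT => //; last first.
  by apply/measurable_EFinP; exact: measurable_funD.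
apply: measurable_and; [|apply: measurable_and].
- apply: measurable_fun_ltr => //.
  exact: (measurableT_comp measurable_snd measurable_fst).
- by apply: measurable_fun_ltr => //; exact: measurable_snd.
- by apply: measurable_fun_lte => //; apply/measurable_EFinP; exact: measurable_snd.
Qed.

Let V_ge0 z : (0 <= V z)%E.
Proof. by rewrite /V; case: ifPn => // _; rewrite lee_fin addr_ge0. Qed.

Let U_ge0 z : (0 <= U z)%E.
Proof.
by rewrite adde_ge0 ?interior_potential_ge0 ?boundary_potential_ge0.
Qed.

Let mU : measurable_fun setT U.
Proof.
apply: emeasurable_funD; first exact: measurable_interior_potential.
exact: measurable_boundary_potential.
Qed.

Let potential := power_potential (leb_time n.+1) (@duhamel_kernel R n) p.

Let measurable_dk (x : space) (t : R) : measurable_fun setT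
  (fun z : spacetime => (duhamel_kernel ((x, t), z))%:E).
Proof.
apply/measurable_EFinP.
by have /(measurable_fun_pair2 (x, t)) := @measurable_duhamel_kernel R n.
Qed.

Let potential_V_le (x : space) (t : R) : Omega x -> 0 < t -> (t%:E < T)%E ->
  (potential V (x, t) <= (2 `^ (p - 1))%:E *
   (\int[leb_time n.+1]_z ((duhamel_kernel ((x, t), z))%:E * (v z `^ p)%:E) +
    \int[leb_time n.+1]_z ((duhamel_kernel ((x, t), z))%:E * (w z `^ p)%:E)))%E.
Proof.
move=> Ox t0 tT.
have mpow (psi : spacetime -> R) : measurable_fun setT psi ->
    measurable_fun setT
      (fun z => ((duhamel_kernel ((x, t), z))%:E * (psi z `^ p)%:E)%E).
  move=> mpsi; apply: emeasurable_funM => //.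
  by apply/measurable_EFinP; exact: (measurableT_comp (measurable_powR p) mpsi).
have pow_ge0 (psi : spacetime -> R) z :
    (0 <= (duhamel_kernel ((x, t), z))%:E * (psi z `^ p)%:E)%E.
  by rewrite -EFinM lee_fin mulr_ge0 ?duhamel_kernel_ge0 ?powR_ge0.
have mpv := mpow v mv; have mpw := mpow w mw.
have msum := emeasurable_funD mpv mpw.
rewrite -(ge0_integralD (leb_time n.+1) measurableT (fun z _ => pow_ge0 v z) mpv
  (fun z _ => pow_ge0 w z) mpw).
rewrite -(ge0_integralZl_EFin (leb_time n.+1) measurableT
  (fun z _ => adde_ge0 (pow_ge0 v z) (pow_ge0 w z)) msum) ?powR_ge0//.
apply: le_integral_ge0 => z _.
  by rewrite mule_ge0 ?poweR_ge0// lee_fin duhamel_kernel_ge0.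
have [zQ|zQ] := boolP (inQT z).
  rewrite /V zQ poweR_EFin -!EFinM lee_fin -mulrDr mulrCA.
  by rewrite ler_wpM2l ?duhamel_kernel_ge0// powR_addr_le// ltW.
have -> : duhamel_kernel ((x, t), z) = 0 :> R.
  rewrite /duhamel_kernel /interior_kernel /=; case: ifPn => // z0.
  case: ifPn => // /and3P[_ z1].
  rewrite subr_gt0 => zt; exfalso; move/negP: zQ; apply.
  by rewrite /inQT z1 z0 /=; apply: lt_trans tT; rewrite lte_fin.
by rewrite !mul0e adde0 mule0.
Qed.

(** The Duhamel term takes the other half: by convexity of the power it is at most
    2^(p-1) (2^(-p) v + 2^(-p) w) = (v + w) / 2. *)
Let supersolution : {ae leb_time n.+1, forall z, (U z + potential V z <= V z)%E}.
Proof.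
apply: (ae_sfprod_sections (m1 := leb n.+1) lebesgue_measure
  (P := fun z => (U z + potential V z <= V z)%E)).
  have mle : measurable_fun setT (fun z => (U z + potential V z <= V z)%E).
    apply: measurable_fun_lee => //; apply: emeasurable_funD => //.
    apply: measurable_power_potential => //.
    - exact: duhamel_kernel_ge0.
    - exact: measurable_duhamel_kernel.
  rewrite (_ : mkset _ = (fun z => (U z + potential V z <= V z)%E) @^-1` [set true])//.
  by rewrite -[X in measurable X]setTI; exact: mle.
move=> t; have [/andP[t0 tT]|tQ] := boolP ((0 < t) && (t%:E < T)%E); last first.
  apply: aeW => x; rewrite [V _]/V /inQT /= (negbTE tQ) andbF; exact: leey.
apply: filterS2 (duhamel_v_le t0 tT) (duhamel_w_le t0 tT) => x vle wle.
have [x0|x0] := ltP 0 (x.2 : R); last first.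
  by rewrite [V _]/V /inQT /= [0 < x.2]ltNge x0 /=; exact: leey.
have inQ : inQT (x, t) by rewrite /inQT /= x0 t0 tT.
rewrite [V (x, t)]/V inQ.
apply: (@le_trans _ _ (((v (x, t) + w (x, t)) / 2)%:E + (2 `^ (p - 1))%:E *
   ((2 `^ (- p) * v (x, t))%:E + (2 `^ (- p) * w (x, t))%:E)))%E.
  apply: leeD; first exact: linear_part_le.
  apply: (le_trans (potential_V_le x0 t0 tT)).
  rewrite lee_wpmul2l ?lee_fin ?powR_ge0//; apply: leeD; [exact: vle|exact: wle].
rewrite -!EFinM -!EFinD lee_fin -mulrDr mulrA -powRD ?pnatr_eq0 ?implybT//.
have -> : p - 1 - p = - 1 by ring.
by rewrite powR_inv1// le_eqVlt; apply/orP; left; apply/eqP; field.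
Qed.

Lemma exists_solution (mu : {measure set space -> \bar R}) : is_datum f h mu ->
  exists u : spacetime -> \bar R,
    solution p mu T u /\
    {ae leb_time n.+1, forall z, QT T z ->
      (0 <= u z <= (fv Phi f z.1 z.2 + fw Phi h z.1 z.2)%:E)%E}.
Proof.
move=> hmu.
have [u [mu_ u0 uE uV]] := exists_solution_below_supersolution
  (@duhamel_kernel_ge0 R n) (@measurable_duhamel_kernel R n)
  U_ge0 mU V_ge0 mV (lt_trans ltr01 p_gt1) supersolution.
have VE z : QT T z -> V z = (fv Phi f z.1 z.2 + fw Phi h z.1 z.2)%:E.
  case: z => x t [/= x0 [t0 tT]].
  by rewrite /V /inQT /= x0 t0 tT /= fvE// fwE.
exists u; split; last first.
  by apply: filterS uV => z uz Qz; rewrite u0 -VE.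
split.
  split=> //.
  - by exists u; [exact: measurable_funTS|exact: aeW].
  - by apply: filterS uV => z uz Qz; rewrite (le_lt_trans uz)// VE// ltry.
apply: aeW => -[x t] [/= x0 [t0 tT]].
rewrite uE /U (integral_K_datum f_ge0 mf1 f1_ge0 ff1 h_ge0 mh1 h1_ge0 hh1 hmu)//.
congr (_ + _)%E; rewrite /power_potential.
rewrite (duhamel_iterated (F := fun z => poweR (u z) p)); last 2 first.
- exact: (measurableT_comp (measurable_poweR p) mu_).
- by move=> z; exact: poweR_ge0.
apply: eq_integral => s; rewrite inE/= in_itv/= => /andP[s0 st].
rewrite [RHS]integral_mkcond; apply: eq_integral => y _.
rewrite patchE /interior_kernel x0 subr_gt0 st andbT /=.
have -> : (y \in @Omega R n.+1) = (0 < y.2) by apply/idP/idP; rewrite inE.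
by case: ifPn => //; rewrite mul0e.
Qed.

End existence.

Unset Implicit Arguments.

Theorem theorem5p2 (R : realType) (N : nat) (hN : (1 <= N)%N)
    (p : R) (hp : 1 < p)
    (f : ambient R N -> R) (hf : in_L f)
    (h : bdry R N -> R) (hh : in_L' h) (hh0 : 2 <= p -> forall x', h x' = 0)
    (mu : {measure set (ambient R N) -> \bar R})
    (hmu : is_datum f h mu) (hmuM : in_M mu)
    (Phi : R -> R)
    (Phi_incr : {in `[0, +oo[ &, {homo Phi : x y / x < y}})
    (Phi_ge0 : forall x, 0 <= x -> 0 <= Phi x)
    (Phi_convex : convex_function (`[0, +oo[%classic : set R) Phi)
    (Phi0 : Phi 0 = 0)
    (T : \bar R) (hT : (0 < T)%E)
    (hGfin : forall t x, 0 < t -> (t%:E < T)%E -> Omega x ->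
      (Gop t (Phi \o f) x < +oo)%E)
    (hGammafin : forall t x', 0 < t -> (t%:E < T)%E ->
      (Gammaop t (Phi \o h) x' < +oo)%E)
    (hsmall_f : {ae leb N, forall x, Omega x -> f x = 0} \/ small_f Phi f p T)
    (hsmall_h : {ae leb_bdry N, forall x', h x' = 0} \/ small_h Phi h p T) :
  exists u : (ambient R N * measurableTypeR R)%type -> \bar R,
    solution p mu T u /\
    {ae leb_time N, forall z, QT T z ->
      (0 <= u z <= (fv Phi f z.1 z.2 + fw Phi h z.1 z.2)%:E)%E}.
Proof.
move: N hN f hf h hh hh0 mu hmu hmuM hGfin hGammafin hsmall_f hsmall_h.
case=> // n _ f hf h hh _ mu hmu _ hGfin hGammafin hsmall_f hsmall_h.
have [f1 [mf1 f1_ge0 ff1]] := in_L_borel hf.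
have [h1 [mh1 h1_ge0 hh1]] := in_L'_borel hh.
exact: (exists_solution hp (proj1 hf) mf1 f1_ge0 ff1 (proj1 hh) mh1 h1_ge0 hh1
  Phi_incr Phi_ge0 Phi_convex Phi0 hGfin hGammafin hsmall_f hsmall_h hmu).
Qed.
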